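(* Let $\Gamma$ be either $\pi_1(S)$, where $S$ is a closed, orientable surface of genus $g\geq 2$, or the free group $F_n$ of finite rank $n\geq 2$. Let $G$ be an arbitrary group and let $\rho\in\mathrm{Hom}(\Gamma,G)$. Suppose that the orbit of $\rho$ under the action of $\mathrm{Aut}(\Gamma)$ on $\mathrm{Hom}(\Gamma,G)$ by precomposition is finite. Then the image $\rho(\Gamma)$ is finite.
   Context: $\mathrm{Hom}(\Gamma,G)$ denotes the set of all group homomorphisms $\Gamma\to G$. The group $\mathrm{Aut}(\Gamma)$ acts on $\mathrm{Hom}(\Gamma,G)$ by precomposition, so the orbit of $\rho$ is $\{\rho\circ\phi : \phi\in\mathrm{Aut}(\Gamma)\}$. *)

(* Defs.v *)
From HB Require Import structures.
From Stdlib Require Import Relation_Operators.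
From mathcomp Require Import all_boot all_order all_algebra.
From mathcomp Require Import all_classical all_reals all_analysis.

Set Implicit Arguments.
Unset Strict Implicit.
Unset Printing Implicit Defensive.

Import Order.TTheory GRing.Theory Num.Theory.
Import numFieldNormedType.Exports.

Local Open Scope classical_set_scope.
Local Open Scope ring_scope.

(** Groups are MathComp's possibly infinite [groupType]s.  The choice operator
    such a type carries is no restriction, the ambient logic being classical. *)

Notation group_hom := UMagmaMorphism.type.

Definition group_aut (Gamma : groupType) : set (group_hom Gamma Gamma) :=
  [set phi | bijective phi].
Arguments group_aut : clear implicits.

Definition aut_orbit (Gamma G : groupType) (rho : group_hom Gamma G) :
    set (group_hom Gamma G) :=
  [set (rho \o phi : group_hom Gamma G) | phi in group_aut Gamma].

Definition free_group_of_rank (n : nat) (F : groupType) : Prop :=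
  exists x : 'I_n -> F,
    forall (H : groupType) (f : 'I_n -> H),
      exists! h : group_hom F H, forall i, h (x i) = f i.

Section FundamentalGroup.
Variables (R : realType) (S : topologicalType).

(** A loop is a map on all of [R] of which only the restriction to [[0, 1]]
    matters: [loop_homotopic] does not see values elsewhere. *)
Definition is_loop (x : S) (p : R -> S) : Prop :=
  [/\ {within `[0, 1]%classic, continuous p}, p 0 = x & p 1 = x].

Definition loop_homotopic (x : S) (p q : R -> S) : Prop :=
  exists H : R * R -> S,
    [/\ {within `[0, 1]%classic `*` `[0, 1]%classic, continuous H},
        forall s : R, 0 <= s <= 1 -> H (s, 0) = p s /\ H (s, 1) = q s
      & forall t : R, 0 <= t <= 1 -> H (0, t) = x /\ H (1, t) = x].

Definition loop_concat (p q : R -> S) : R -> S :=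
  fun s => if s <= 2^-1 then p (2 * s) else q (2 * s - 1).

(** [Gamma] is (isomorphic to) the group of homotopy classes of loops at [x]:
    [cls] induces a bijection from these classes onto [Gamma] which turns
    concatenation into the product. *)
Definition is_fundamental_group (x : S) (Gamma : groupType) : Prop :=
  exists cls : (R -> S) -> Gamma,
    [/\ forall c : Gamma, exists2 p, is_loop x p & cls p = c,
        forall p q, is_loop x p -> is_loop x q ->
          (cls p = cls q <-> loop_homotopic x p q)
      & forall p q, is_loop x p -> is_loop x q ->
          cls (loop_concat p q) = (cls p * cls q)%g].

End FundamentalGroup.

Section Surface.
Variable R : realType.

Definition unit_disk : set (R * R) := [set z | z.1 ^+ 2 + z.2 ^+ 2 <= 1].

(** The unit circle is cut into [4 * g] arcs of equal length, numbered
    anticlockwise from [0]; [polygon_side g k] parametrizes the [k]-th one,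
    anticlockwise, by [s] in [[0, 1]]. *)
Definition polygon_side (g k : nat) (s : R) : R * R :=
  let theta := 2 * pi * ((k%:R + s) / (4 * g)%:R) in (cos theta, sin theta).

(** Sides [4i], [4i+1], [4i+2], [4i+3] carry the labels
    a_i, b_i, a_i^-1, b_i^-1, so that the boundary of the disk reads
    [a_0, b_0] ... [a_(g-1), b_(g-1)]. *)
Definition side_pairing (g : nat) (z w : R * R) : Prop :=
  exists (i : nat) (s : R),
    [/\ (i < g)%N, 0 <= s <= 1 &
        (z = polygon_side g (4 * i) s /\
         w = polygon_side g (4 * i + 2) (1 - s)) \/
        (z = polygon_side g (4 * i + 1) s /\
         w = polygon_side g (4 * i + 3) (1 - s))].

(** [S] is homeomorphic to the disk with its sides glued in pairs: [q] is a
    topological quotient map from the disk (with the topology induced by the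
    plane) onto [S], whose fibres are the classes of the equivalence relation
    generated by the pairing. *)
Definition closed_orientable_surface (g : nat) (S : topologicalType) : Prop :=
  exists q : R * R -> S,
    [/\ q @` unit_disk = setT,
        forall U : set S,
          open U <-> exists2 V : set (R * R),
                       open V & unit_disk `&` q @^-1` U = unit_disk `&` V
      & forall z w, unit_disk z -> unit_disk w ->
          (q z = q w <-> clos_refl_sym_trans (R * R) (side_pairing g) z w)].

Definition surface_group (g : nat) (Gamma : groupType) : Prop :=
  exists (S : topologicalType) (x : S),
    closed_orientable_surface g S /\ is_fundamental_group R x Gamma.

End Surface.

(* Main.v *)
Require Import Defs.
From HB Require Import structures.
From Stdlib Require Import Relation_Operators.
From mathcomp Require Import all_boot all_order all_algebra.
From mathcomp Require Import all_classical all_reals all_analysis.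
From mathcomp Require Import lra zify.

Set Implicit Arguments.
Unset Strict Implicit.
Unset Printing Implicit Defensive.

Import Order.TTheory GRing.Theory Num.Theory.
Import numFieldNormedType.Exports.

Local Open Scope classical_set_scope.

(** Let [X] be the set of values that the homomorphisms in the orbit of [rho]
    take at finitely many generators of [Gamma].  If the orbit is finite, so is
    [X], and [X] is stable under conjugation by [rho Gamma] because inner
    automorphisms belong to [Aut(Gamma)].  Suppose that for each generator [y]
    there is an element [c] such that every [c * y ^+ m] is the image of [c]
    under an automorphism.  Then for [psi] in the orbit the products
    [psi c * psi y ^+ m] take finitely many values, so [psi y] is torsion.  By
    Dietzmann's lemma, a finite set of torsion elements that is stable under
    conjugation generates a finite group; here this group contains
    [rho Gamma].  This is [finite_range_of_twists], and it remains to find such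
    generators and automorphisms.

    For a free group the automorphisms multiply one basis element by a power of
    another one.  For a surface group they are powers of Dehn twists, and the
    work lies in obtaining the presentation of the fundamental group from its
    definition by loops ([surface_presentation]).  To that end the surface is
    written as a quotient of the unit square by an equivalence relation that is
    a finite union of affine pieces ([affine_gluing], [surface_gluing]).

    In such a quotient let [develop z] be the class of the image of the straight
    path of the square that leads to [z].  If [z] and [w] have the same image,
    the transition [develop z * (develop w)^-1] is a class of loops, and it is
    constant along each piece.  Two facts replace van Kampen's theorem.
    Transitions generate the fundamental group ([transitions_generate]): a short
    path can be contracted along images of straight segments, and every loop is
    a product of short paths.  And for every function [lam] from the square to
    a group [H] whose transitions are constant along each piece, there is a
    homomorphism sending the transitions of [develop] to those of [lam]
    ([transitions_extend]): [lam] defines a local system, and the homomorphism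
    is its monodromy. *)

(** * Finite orbits and Dietzmann's lemma *)

Section GroupTheory.
Local Open Scope group_scope.

Definition is_subgroup (G : groupType) (P : set G) :=
  [/\ P 1, forall a b, P a -> P b -> P (a * b) & forall a, P a -> P a^-1].

(** Generation is expressed without words, so that it can be used as an
    induction principle. *)
Definition generates (G : groupType) (A : set G) :=
  forall P : set G, is_subgroup P -> A `<=` P -> forall g, P g.

Lemma morph_group1 (G H : groupType) (f : G -> H) :
  {morph f : x y / x * y} -> f 1 = 1.
Proof. by move=> fM; apply: (mulgI (f 1)); rewrite -fM !mulg1. Qed.

Lemma hom_ext (G H : groupType) (f g : group_hom G H) : f =1 g -> f = g.
Proof.
case: f g => [f [[f1] [fM]]] [g [[g1] [gM]]] /= /funext eqfg.
rewrite -eqfg in g1 gM *.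
by rewrite (Prop_irrelevance f1 g1) (Prop_irrelevance fM gM).
Qed.

Definition hom_of (G H : groupType) (f : G -> H)
    (fM : {morph f : x y / x * y}) : group_hom G H :=
  HB.pack f (isUMagmaMorphism.Build G H f (morph_group1 fM, fM)).

Definition wprod (G : groupType) (w : seq G) : G := \prod_(x <- w) x.

Lemma wprod_cons (G : groupType) (x : G) w : wprod (x :: w) = x * wprod w.
Proof. by rewrite /wprod big_cons. Qed.

Lemma wprod_cat (G : groupType) (v w : seq G) :
  wprod (v ++ w) = wprod v * wprod w.
Proof. by rewrite /wprod big_cat. Qed.

Section Dietzmann.
Variables (G : groupType) (X : seq G) (N : nat).
Hypothesis N_gt0 : (0 < N)%N.
Hypothesis XN : {in X, forall x, x ^+ N = 1}.
Hypothesis XJ : {in X &, forall x y, x ^ y \in X}.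

Lemma conj_expg_mem x y k : x \in X -> y \in X -> x ^ (y ^+ k) \in X.
Proof.
move=> xX yX; elim: k => [|k IHk]; first by rewrite expg0 conjg1.
by rewrite expgSr conjgM XJ.
Qed.

Lemma pull_power x k w : x \in X -> {subset w <= X} -> (k <= count_mem x w)%N ->
  exists w', [/\ {subset w' <= X}, (size w' + k)%N = size w
               & wprod w = x ^+ k * wprod w'].
Proof.
move=> xX; elim: w k => [|y w IHw] k wX /=.
  by rewrite leqn0 => /eqP->; exists [::]; split; rewrite ?expg0 ?mul1g.
have yX : y \in X by apply: wX; rewrite mem_head.
have {}wX : {subset w <= X} by move=> z zw; apply: wX; rewrite inE zw orbT.
have [->{y yX}|neq_yx] := eqVneq y x; last first.
  rewrite add0n => /(IHw _ wX)[w' [w'X sz eqw]].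
  exists (y ^ (x ^+ k) :: w'); split.
  - by move=> z; rewrite inE => /predU1P[->|/w'X//]; apply: conj_expg_mem.
  - by rewrite /= addSn sz.
  - by rewrite !wprod_cons eqw conjgE !mulgA mulgV mul1g.
case: k => [|k] lek; last first.
  have [w' [w'X sz eqw]] := IHw k wX lek.
  exists w'; split=> //; first by rewrite addnS sz.
  by rewrite wprod_cons eqw expgS mulgA.
exists (x :: w); split; rewrite ?addn0 ?expg0 ?mul1g //.
by move=> z; rewrite inE => /predU1P[->|/wX].
Qed.

Lemma size_le_sum_count (w : seq G) : {subset w <= X} ->
  (size w <= \sum_(x <- X) count_mem x w)%N.
Proof.
elim: w => [|y w IHw] wX //=.
have yX : y \in X by apply: wX; rewrite mem_head.
rewrite big_split /= -[in leqLHS]add1n leq_add //; last first.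
  by apply: IHw => z zw; apply: wX; rewrite inE zw orbT.
by rewrite (big_rem y yX) /= eqxx.
Qed.

(** As a power that occurs in a word can be pulled to its front, at the price
    of conjugating the letters it jumps over, a word in which some letter
    occurs [N] times can be shortened. *)
Lemma short_word w : {subset w <= X} -> exists2 v : seq G,
  {subset v <= X} /\ (size v <= size X * N)%N & wprod v = wprod w.
Proof.
have [n] := ubnP (size w); elim: n w => // n IHn w szw wX.
have [lew|ltw] := leqP (size w) (size X * N)%N; first by exists w.
have [x xX ltN] : exists2 x, x \in X & (N <= count_mem x w)%N.
  apply/hasP/negPn/negP => /hasPn noX; move: ltw; rewrite ltnNge => /negP[].
  apply: leq_trans (size_le_sum_count wX) _.
  rewrite mulnC -iter_addn_0 -count_predT -big_const_seq big_seq [leqRHS]big_seq.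
  by apply: leq_sum => x /noX; rewrite -ltnNge => /ltnW.
have [w' [w'X sz ->]] := pull_power xX wX ltN.
by rewrite XN // mul1g; apply: IHn => //; move: szw; rewrite -sz; lia.
Qed.

Lemma finite_short_words n :
  finite_set [set wprod w | w in [set w | {subset w <= X} /\ (size w <= n)%N]].
Proof.
elim: n => [|n IHn].
  apply: (@sub_finite_set _ _ [set 1]) (finite_set1 _) => _ [w [_ szw] <-].
  by move: szw; rewrite leqn0 => /nilP->; rewrite /wprod big_nil.
apply: (@sub_finite_set _ _ ([set 1] `|` [set x * y | x in [set` X] & y in
  [set wprod w | w in [set w | {subset w <= X} /\ (size w <= n)%N]]])).
  move=> _ [[|x w] [wX szw] <-]; first by left; rewrite /wprod big_nil.
  right; exists x; first by apply: wX; rewrite mem_head.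
  exists (wprod w); last by rewrite wprod_cons.
  by exists w => //; split=> // z zw; apply: wX; rewrite inE zw orbT.
rewrite finite_setU; split; first exact: finite_set1.
by apply: finite_image2 => //; exact: finite_seq.
Qed.

(** The inverse of a letter is a positive power of it. *)
Lemma words_inverse w : {subset w <= X} -> exists2 v : seq G,
  {subset v <= X} & wprod v = (wprod w)^-1.
Proof.
elim: w => [|x w IHw] wX.
  by exists [::] => //; rewrite /wprod big_nil invg1.
have xX : x \in X by apply: wX; rewrite mem_head.
have [|v vX eqv] := IHw; first by move=> z zw; apply: wX; rewrite inE zw orbT.
exists (v ++ nseq N.-1 x).
  by move=> z; rewrite mem_cat => /orP[/vX//|]; rewrite mem_nseq => /andP[_ /eqP->].
rewrite wprod_cat eqv wprod_cons invgM; congr (_ * _).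
apply: (mulIg x); rewrite mulVg -[RHS](XN xX).
rewrite -[in RHS](prednK N_gt0) expgSr; congr (_ * _).
by rewrite /wprod; elim: N.-1 => [|k IHk]; rewrite ?big_nil // big_cons IHk expgS.
Qed.

Lemma words_subgroup : is_subgroup [set g | exists2 w, {subset w <= X} & wprod w = g].
Proof.
split.
- by exists [::] => //; rewrite /wprod big_nil.
- move=> _ _ [v vX <-] [w wX <-]; exists (v ++ w); last exact: wprod_cat.
  by move=> z; rewrite mem_cat => /orP[/vX|/wX].
- by move=> _ [w /words_inverse[v vX eqv] <-]; exists v.
Qed.

(** Dietzmann's lemma. *)
Lemma finite_words : finite_set [set g | exists2 w, {subset w <= X} & wprod w = g].
Proof.
apply: sub_finite_set (finite_short_words (size X * N)%N) => _ [w wX <-].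
by have [v [vX szv] eqv] := short_word wX; exists v.
Qed.

End Dietzmann.

Lemma finite_powers_torsion (G : groupType) (a b : G) (A : set G) :
  finite_set A -> (forall m, A (a * b ^+ m)) -> exists2 n, (0 < n)%N & b ^+ n = 1.
Proof.
move=> finA Am.
have [m [n [ltmn eqmn]]] : exists m n, (m < n)%N /\ a * b ^+ m = a * b ^+ n.
  apply: contrapT => inj; apply: infinite_nat.
  rewrite (_ : setT = (fun m => a * b ^+ m) @^-1` A); last first.
    by apply/seteqP; split=> m //= _; exact: Am.
  apply: finite_preimage finA => m n _ _ eqmn.
  have [ltmn|ltnm|//] := ltngtP m n; exfalso; apply: inj.
    by exists m, n.
  by exists n, m.
exists (n - m)%N; first by rewrite subn_gt0.
apply: (mulgI (b ^+ m)); apply: (mulgI a).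
by rewrite mulg1 -expgnDr subnKC // ltnW.
Qed.

Lemma common_exponent (G : groupType) (X : seq G) :
  (forall x, x \in X -> exists2 n, (0 < n)%N & x ^+ n = 1) ->
  exists2 N, (0 < N)%N & {in X, forall x, x ^+ N = 1}.
Proof.
elim: X => [|x X IHX] tX; first by exists 1%N.
have [n n0 xn] := tX x (mem_head _ _).
have [|N N0 XN] := IHX; first by move=> y yX; apply: tX; rewrite inE yX orbT.
exists (n * N)%N; first by rewrite muln_gt0 n0.
move=> y; rewrite inE => /predU1P[->|yX]; first by rewrite expgnA xn expg1n.
by rewrite mulnC expgnA XN // expg1n.
Qed.

Lemma conj_aut (Gamma : groupType) (c : Gamma) :
  exists2 phi : group_hom Gamma Gamma, group_aut Gamma phi
    & forall x, phi x = x ^ c.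
Proof.
exists (hom_of (fun x y : Gamma => conjMg x y c)) => //.
suff: bijective (fun x : Gamma => x ^ c) by [].
by exists (fun x => x ^ c^-1) => x; rewrite -conjgM ?mulgV ?mulVg conjg1.
Qed.

Lemma aut_comp (Gamma : groupType) (phi chi : group_hom Gamma Gamma) :
  group_aut Gamma phi -> group_aut Gamma chi ->
  group_aut Gamma (phi \o chi : group_hom Gamma Gamma).
Proof.
move=> bphi bchi; suff: bijective (phi \o chi) by [].
exact: bij_comp.
Qed.

Lemma orbit_precomp (Gamma G : groupType) (rho psi : group_hom Gamma G)
    (phi : group_hom Gamma Gamma) :
  aut_orbit rho psi -> group_aut Gamma phi ->
  aut_orbit rho (psi \o phi : group_hom Gamma G).
Proof.
move=> [chi bchi <-] bphi.
exists (chi \o phi : group_hom Gamma Gamma); first exact: aut_comp.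
by apply: hom_ext.
Qed.

(** Dietzmann's lemma is applied to the set of all values that homomorphisms in
    the orbit take at the generators; the automorphisms sending [c] to
    [c * y ^+ m] make these values torsion. *)
Theorem finite_range_of_twists (Gamma G : groupType) (A : set Gamma)
    (rho : group_hom Gamma G) :
  finite_set A -> generates A ->
  (forall y, A y -> exists c, forall m, exists2 phi, group_aut Gamma phi
     & phi c = c * y ^+ m) ->
  finite_set (aut_orbit rho) -> finite_set (range rho).
Proof.
move=> finA genA twA finO.
pose X0 := [set psi y | psi in aut_orbit rho & y in A].
have finX0 : finite_set X0 by apply: finite_image2.
have /finite_seqP[X eqX] := finX0.
have memX z : (z \in X) = (z \in X0) by rewrite eqX; apply/idP/idP; rewrite inE.
have [N N_gt0 XN] : exists2 N, (0 < N)%N & {in X, forall x, x ^+ N = 1}.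
  apply: common_exponent => x; rewrite memX inE => -[psi Opsi [y Ay <-]].
  have [c twc] := twA y Ay.
  apply: (@finite_powers_torsion _ (psi c) _ [set chi c | chi in aut_orbit rho]).
    exact: finite_image.
  move=> m; have [phi bphi eqphi] := twc m.
  exists (psi \o phi : group_hom Gamma G); first exact: orbit_precomp.
  by rewrite /= eqphi gmulfM gmulfXn.
have XJ : {in X &, forall x y, x ^ y \in X}.
  move=> x z; rewrite !memX !inE => -[psi Opsi [y Ay <-]] [_ [chi bchi <-] [y' Ay' <-]].
  case: Opsi => phi bphi eqpsi.
  have [phi' bphi' phiE] := conj_aut (chi y').
  exists (rho \o (phi' \o phi : group_hom Gamma Gamma) : group_hom Gamma G).
    by exists (phi' \o phi : group_hom Gamma Gamma) => //; exact: aut_comp.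
  by exists y => //=; rewrite phiE gmulfJ -eqpsi.
apply: sub_finite_set (finite_words N_gt0 XN XJ) => _ [g _ <-].
have [w1 wM wV] := words_subgroup N_gt0 XN.
apply: (genA (rho @^-1` [set g | exists2 w, {subset w <= X} & wprod w = g])).
  split=> /=; rewrite ?gmulf1 //.
  - by move=> a b Pa Pb; rewrite gmulfM; exact: wM.
  - by move=> a Pa; rewrite gmulfV; exact: wV.
move=> y Ay; exists [:: rho y]; last by rewrite wprod_cons /wprod big_nil mulg1.
move=> z; rewrite inE => /eqP->; rewrite memX inE.
exists rho; last by exists y.
exists (idfun : group_hom Gamma Gamma); last exact: hom_ext.
suff: bijective (@idfun Gamma) by [].
by exists id.
Qed.

End GroupTheory.

(** * Free groups *)

Section FreeGroup.
Local Open Scope group_scope.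

Section Subgroup.
Variables (G : groupType) (P : set G).
Hypothesis P_subgroup : is_subgroup P.

Definition subgroup_pred : pred G := fun g => `[< P g >].
(** The proof is an argument of the type so that the group structure can be
    found from the type. *)
Definition subgroup_type (_ : is_subgroup P) := {g : G | subgroup_pred g}.

HB.instance Definition _ := SubChoice.on (subgroup_type P_subgroup).

Lemma subgroup_pred_closed : group_closed subgroup_pred.
Proof.
have [P1 PM PV] := P_subgroup.
split; first exact/asboolP.
by move=> x y /asboolP Px /asboolP Py; apply/asboolP/PM => //; apply: PV.
Qed.

HB.instance Definition _ := SubChoice_isSubGroup.Build G subgroup_pred
  (subgroup_type P_subgroup) subgroup_pred_closed.

End Subgroup.

(** Let [P] be a subgroup that contains the basis.  The map [x i |-> x i] into
    [P] extends to a homomorphism; followed by the inclusion it is the identity,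
    by uniqueness. *)
Lemma free_generates n (F : groupType) (x : 'I_n -> F) :
  (forall (H : groupType) (f : 'I_n -> H),
      exists! h : group_hom F H, forall i, h (x i) = f i) ->
  generates (range x).
Proof.
move=> univ P Psub xP g.
have Px i : subgroup_pred P (x i) by apply/asboolP/xP; exists i.
have [h [hx _]] := univ (subgroup_type Psub) (fun i => Sub (x i) (Px i)).
have [h0 [_ h0_uniq]] := univ F x.
have valhM : {morph (fun a => val (h a)) : a b / a * b}.
  by move=> a b; rewrite gmulfM.
pose incl : group_hom F F := hom_of valhM.
have <- : incl g = g.
  rewrite -(h0_uniq incl) => [|i]; last by rewrite /= hx SubK.
  by rewrite (h0_uniq idfun).
exact/asboolP/(valP (h g)).
Qed.

(** The inverse automorphism multiplies [x j] by [x i ^- m]. *)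
Lemma free_group_twist n (F : groupType) (x : 'I_n -> F) (i j : 'I_n) m :
  (forall (H : groupType) (f : 'I_n -> H),
      exists! h : group_hom F H, forall i, h (x i) = f i) ->
  i != j -> exists2 phi, group_aut F phi & phi (x j) = x j * x i ^+ m.
Proof.
move=> univ neq_ij.
have twist (z : F) : exists h : group_hom F F,
    forall k, h (x k) = x k * (if k == j then z else 1).
  by have [h [hx _]] := univ F (fun k => x k * (if k == j then z else 1)); exists h.
have [h hx] := twist (x i ^+ m); have [h' h'x] := twist (x i ^- m).
have [h0 [_ h0_uniq]] := univ F x.
have hi : h (x i) = x i by rewrite hx (negPf neq_ij) mulg1.
have h'i : h' (x i) = x i by rewrite h'x (negPf neq_ij) mulg1.
exists h; last by rewrite hx eqxx.
suff: bijective h by [].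
exists h' => g.
  rewrite -[RHS](_ : h0 g = g); last by rewrite (h0_uniq idfun).
  rewrite (h0_uniq (h' \o h : group_hom F F)) // => k /=.
  rewrite hx gmulfM h'x; case: eqP => _; last by rewrite gmulf1 !mulg1.
  by rewrite gmulfXn h'i mulgVK.
rewrite -[RHS](_ : h0 g = g); last by rewrite (h0_uniq idfun).
rewrite (h0_uniq (h \o h' : group_hom F F)) // => k /=.
rewrite h'x gmulfM hx; case: eqP => _; last by rewrite gmulf1 !mulg1.
by rewrite gmulfV gmulfXn hi mulgK.
Qed.

Lemma free_group_case n (F G : groupType) (rho : group_hom F G) :
  (2 <= n)%N -> free_group_of_rank n F -> finite_set (aut_orbit rho) ->
  finite_set (range rho).
Proof.
move=> n2 [x univ]; apply: (finite_range_of_twists (A := range x)).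
- exact: finite_image.
- exact: free_generates univ.
move=> _ [i _ <-].
have [j neq_ij] : exists j, i != j.
  case: n n2 x univ i => [|[|n]] // _ _ _ i.
  have [->|i0] := eqVneq i ord0; last by exists ord0.
  by exists (lift ord0 ord0).
by exists (x j) => m; apply: free_group_twist.
Qed.

End FreeGroup.

(** * Continuous functions *)

Section Continuity.
Local Open Scope ring_scope.

Lemma continuous_retract (T U V : topologicalType) (A : set T) (f : T -> V)
    (r : U -> T) :
  {within A, continuous f} -> continuous r -> (forall u, A (r u)) ->
  continuous (f \o r).
Proof.
move=> /subspace_continuousP cf cr Ar u N /= Nfu.
have crN := cr u _ (cf (r u) (Ar u) N Nfu).
by move: crN; rewrite /nbhs /=; apply: filterS => v /(_ (Ar v)).
Qed.

Section RealFunctions.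
Variables (R : realType) (T : topologicalType).
Implicit Types f g : T -> R.

Lemma cont_cst (U : topologicalType) (c : U) : continuous (fun _ : T => c).
Proof. by move=> x; exact: cvg_cst. Qed.

Lemma cont_id : continuous (fun x : T => x).
Proof. by move=> x; exact: cvg_id. Qed.

Lemma cont_add f g : continuous f -> continuous g ->
  continuous (fun x => f x + g x).
Proof. by move=> cf cg x; apply: cvgD; [exact: cf|exact: cg]. Qed.

Lemma cont_opp f : continuous f -> continuous (fun x => - f x).
Proof. by move=> cf x; apply: cvgN; exact: cf. Qed.

Lemma cont_mul f g : continuous f -> continuous g ->
  continuous (fun x => f x * g x).
Proof. by move=> cf cg x; apply: cvgM; [exact: cf|exact: cg]. Qed.

Lemma cont_norm f : continuous f -> continuous (fun x => `|f x|).
Proof. by move=> cf x; apply: cvg_norm; exact: cf. Qed.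

Lemma cont_min f g : continuous f -> continuous g ->
  continuous (fun x => Num.min (f x) (g x)).
Proof. by move=> cf cg x; apply: continuous_min; [exact: cf|exact: cg]. Qed.

Lemma cont_max f g : continuous f -> continuous g ->
  continuous (fun x => Num.max (f x) (g x)).
Proof. by move=> cf cg x; apply: continuous_max; [exact: cf|exact: cg]. Qed.

Lemma cont_comp (U V : topologicalType) (h : U -> V) (f : T -> U) :
  continuous h -> continuous f -> continuous (fun x => h (f x)).
Proof. by move=> ch cf x; apply: continuous_comp; [exact: cf|exact: ch]. Qed.

Lemma cont_pair (U V : topologicalType) (f : T -> U) (g : T -> V) :
  continuous f -> continuous g -> continuous (fun x => (f x, g x)).
Proof. by move=> cf cg x; apply: cvg_pair; [exact: cf|exact: cg]. Qed.

Lemma cont_fst (U V : topologicalType) (f : T -> U * V) :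
  continuous f -> continuous (fun x => (f x).1).
Proof. by move=> cf x; apply: continuous_comp; [exact: cf|exact: cvg_fst]. Qed.

Lemma cont_snd (U V : topologicalType) (f : T -> U * V) :
  continuous f -> continuous (fun x => (f x).2).
Proof. by move=> cf x; apply: continuous_comp; [exact: cf|exact: cvg_snd]. Qed.

(** The pasting lemma for two closed sets cut out by a real function. *)
Lemma cont_paste (U : topologicalType) (phi : T -> R) (f g : T -> U) :
  continuous phi -> continuous f -> continuous g ->
  (forall x, phi x = 0 -> f x = g x) ->
  continuous (fun x => if phi x <= 0 then f x else g x).
Proof.
move=> cphi cf cg fg x N /= Nx.
suff : \forall y \near x, N (if phi y <= 0 then f y else g y) by [].
move: Nx; have [phi_lt0|phi_gt0|phi0] := ltgtP (phi x) 0 => Nx.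
- have fN : \forall y \near x, N (f y) by exact: cf.
  have phiN : \forall y \near x, phi y < 0 := cphi x _ (lt_nbhsl phi_lt0).
  by move: fN phiN; apply: filterS2 => y Ny /ltW ->.
- have gN : \forall y \near x, N (g y) by exact: cg.
  have phiN : \forall y \near x, 0 < phi y := cphi x _ (lt_nbhsr phi_gt0).
  by move: gN phiN; apply: filterS2 => y Ny; rewrite ltNge => /negPf ->.
- have fN : \forall y \near x, N (f y) by exact: cf.
  have gN : \forall y \near x, N (g y) by apply: (cg x); rewrite -fg.
  by move: fN gN; apply: filterS2 => y Nf Ng; case: ifP.
Qed.

End RealFunctions.


Definition clamp (R : realType) (s : R) : R := Num.max 0 (Num.min s 1).

Lemma clamp_in (R : realType) (s : R) : 0 <= clamp s <= 1.
Proof. by rewrite /clamp le_max lexx /= ge_max ge_min lexx ler01 orbT. Qed.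

Lemma clamp_id (R : realType) (s : R) : 0 <= s <= 1 -> clamp s = s.
Proof. by move=> /andP[s0 s1]; rewrite /clamp min_l // max_r. Qed.

Lemma clamp_le0 (R : realType) (s : R) : s <= 0 -> clamp s = 0.
Proof. by move=> s0; rewrite /clamp max_l // ge_min s0. Qed.

Lemma clamp_ge1 (R : realType) (s : R) : 1 <= s -> clamp s = 1.
Proof. by move=> s1; rewrite /clamp min_r // max_r. Qed.

Lemma cont_clamp (R : realType) (T : topologicalType) (f : T -> R) :
  continuous f -> continuous (fun x => clamp (f x)).
Proof.
by move=> cf; apply: cont_max; [exact: cont_cst|apply: cont_min => //; exact: cont_cst].
Qed.

Definition seg (R : realType) (z w : R * R) (t : R) : R * R :=
  ((1 - t) * z.1 + t * w.1, (1 - t) * z.2 + t * w.2).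

Lemma cont_seg (R : realType) (T : topologicalType) (f g : T -> R * R) (h : T -> R) :
  continuous f -> continuous g -> continuous h ->
  continuous (fun z => seg (f z) (g z) (h z)).
Proof.
move=> cf cg ch; rewrite /seg.
apply: cont_pair; apply: cont_add; apply: cont_mul; try exact: cont_fst;
  try exact: cont_snd; try exact: ch.
  by apply: cont_add; [exact: cont_cst|exact: cont_opp].
by apply: cont_add; [exact: cont_cst|exact: cont_opp].
Qed.

End Continuity.

(** Extended below by the continuity of maps introduced later. *)
Ltac cont_base := fail.


Ltac cont_step :=
  lazymatch goal with
  | |- continuous (fun _ => ?c) => exact: cont_cst
  | |- continuous (fun z => z) => exact: cont_id
  | |- continuous (fun z => (@?f z + @?g z)%R) => apply: (@cont_add _ _ f g)
  | |- continuous (fun z => (- @?f z)%R) => apply: (@cont_opp _ _ f)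
  | |- continuous (fun z => (@?f z * @?g z)%R) => apply: (@cont_mul _ _ f g)
  | |- continuous (fun z => `|@?f z|%R) => apply: (@cont_norm _ _ f)
  | |- continuous (fun z => Num.min (@?f z) (@?g z)) => apply: (@cont_min _ _ f g)
  | |- continuous (fun z => Num.max (@?f z) (@?g z)) => apply: (@cont_max _ _ f g)
  | |- continuous (fun z => clamp (@?f z)) => apply: (@cont_clamp _ _ f)
  | |- continuous (fun z => (@?f z, @?g z)) => apply: (@cont_pair _ _ _ f g)
  | |- continuous (fun z => (@?f z).1) => apply: (@cont_fst _ _ _ f)
  | |- continuous (fun z => (@?f z).2) => apply: (@cont_snd _ _ _ f)
  | |- continuous (fun z => seg (@?f z) (@?g z) (@?h z)) =>
      apply: (@cont_seg _ _ f g h)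
  | |- continuous (fun z => ?h (@?f z)) => apply: (@cont_comp _ _ _ h f)
  | |- continuous ?f => first [assumption | cont_base]
  | |- _ => by []
  end.
Ltac cont := repeat cont_step.

Section IntervalInduction.
Local Open Scope ring_scope.

(** This is the compactness of [[0, 1]]: the supremum of the [b] such that
    [P 0 b] holds can only be [1]. *)
Lemma interval_induction (R : realType) (P : R -> R -> Prop) :
  (forall a b c, a <= b -> b <= c -> P a b -> P b c -> P a c) ->
  (forall t, 0 <= t <= 1 -> exists2 e, 0 < e &
     forall a b, 0 <= a -> b <= 1 -> a <= t <= b -> t - e < a -> b < t + e -> P a b) ->
  P 0 1.
Proof.
move=> Padd Ploc.
pose A : set R := [set b | 0 <= b <= 1 /\ P 0 b].
have A0 : A 0.
  split; first by lra.
  have [|e e0 Pe] := Ploc 0; first by lra.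
  by apply: Pe; lra.
have ubA : ubound A 1 by move=> b [/andP[]].
have supA : has_sup A by split; [exists 0|exists 1].
have [t tE] : exists t, t = sup A by exists (sup A).
have t01 : 0 <= t <= 1.
  rewrite tE; apply/andP; split; first by apply: ub_le_sup => //; exists 1.
  by apply: ge_sup => //; exists 0.
have [e e0 Pe] := Ploc t t01.
have [a [a01 Pa] lta] := sup_adherent e0 supA.
rewrite -tE in lta.
have leat : a <= t by rewrite tE; apply: ub_le_sup; [exists 1|].
have [b [tb bte b1 b_1]] : exists b, [/\ t <= b, b < t + e, b <= 1 & b <= t -> b = 1].
  have [te|te] := leP (t + e / 2) 1; last by exists 1; split; lra.
  by exists (t + e / 2); split; lra.
have Pb : P 0 b by apply: (Padd 0 a b) => //; [lra|lra|apply: Pe; lra].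
have leb : b <= t by rewrite tE; apply: ub_le_sup; [exists 1|split => //; lra].
by rewrite -(b_1 leb).
Qed.

End IntervalInduction.

(** * The fundamental groupoid, retracted onto the fundamental group *)

Section Loops.
Local Open Scope ring_scope.
Variables (R : realType) (S : topologicalType) (x : S) (Gamma : groupType).
Variable cls : (R -> S) -> Gamma.
Hypothesis cls_homotopic : forall p q, is_loop x p -> is_loop x q ->
  (cls p = cls q <-> loop_homotopic x p q).
Hypothesis cls_concat : forall p q, is_loop x p -> is_loop x q ->
  cls (loop_concat p q) = (cls p * cls q)%g.

Lemma continuous_is_loop (p : R -> S) :
  continuous p -> p 0 = x -> p 1 = x -> is_loop x p.
Proof. by move=> cp p0 p1; split => //; exact: continuous_subspaceT. Qed.

Lemma cls_homotopy (H : R * R -> S) : continuous H ->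
  (forall t, H (0, t) = x) -> (forall t, H (1, t) = x) ->
  cls (fun s => H (s, 0)) = cls (fun s => H (s, 1)).
Proof.
move=> cH H0 H1.
have loopH t : is_loop x (fun s => H (s, t)).
  by apply: continuous_is_loop => //; apply: cont_comp => //; cont.
apply/cls_homotopic => //; exists H; split => //.
exact: continuous_subspaceT.
Qed.

Lemma cls_ext (p q : R -> S) : is_loop x p -> is_loop x q ->
  (forall s, 0 <= s <= 1 -> p s = q s) -> cls p = cls q.
Proof.
move=> lp lq pq; apply/cls_homotopic => //.
have [cp p0 p1] := lp.
exists (fun z => p (clamp z.1)); split.
- apply: continuous_subspaceT; apply: (continuous_retract cp).
    by cont.
  by move=> u; rewrite /= in_itv /= clamp_in.
- by move=> s s01; rewrite clamp_id //= pq.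
- by move=> t _; rewrite /= !clamp_id ?lexx ?ler01.
Qed.

Definition seg_cls (f : R -> S) (a b : R) := cls (fun s => f (a + (b - a) * s)).

Section SegCls.
Variables (f : R -> S) (a b : R).
Hypotheses (cf : continuous f) (fa : f a = x) (fb : f b = x).

Lemma seg_loop : is_loop x (fun s => f (a + (b - a) * s)).
Proof.
apply: continuous_is_loop; rewrite ?mulr0 ?addr0 ?mulr1 ?subrKC //.
by cont.
Qed.

End SegCls.

Lemma seg_cls_htpy (H : R * R -> S) a b : continuous H ->
  (forall t, H (a, t) = x) -> (forall t, H (b, t) = x) ->
  seg_cls (fun s => H (s, 0)) a b = seg_cls (fun s => H (s, 1)) a b.
Proof.
move=> cH Ha Hb; rewrite /seg_cls.
apply: (cls_homotopy (H := fun z => H (a + (b - a) * z.1, z.2))).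
- by cont.
- by move=> t /=; rewrite mulr0 addr0.
- by move=> t /=; rewrite mulr1 subrKC.
Qed.

(** Two ways of running through an interval with the same end points are related
    by a straight-line homotopy. *)
Lemma seg_cls_reparam (f : R -> S) (al : R -> R) a b :
  continuous f -> continuous al -> f (al a) = x -> f (al b) = x ->
  seg_cls (fun u => f (al u)) a b = seg_cls f (al a) (al b).
Proof.
move=> cf cal fa fb; rewrite /seg_cls.
pose H (z : R * R) := f ((1 - z.2) * al (a + (b - a) * z.1)
                         + z.2 * (al a + (al b - al a) * z.1)).
have cH : continuous H by rewrite /H; cont.
have H0 t : H (0, t) = x by rewrite /H /= !mulr0 !addr0 -mulrDl subrK mul1r.
have H1 t : H (1, t) = x by rewrite /H /= !mulr1 !subrKC -mulrDl subrK mul1r.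
have := cls_homotopy cH H0 H1; rewrite /H /=.
under eq_fun do rewrite subr0 mul1r mul0r addr0.
by under [in RHS]eq_fun do rewrite subrr mul0r add0r mul1r.
Qed.

Lemma seg_cls_add (f : R -> S) a b c :
  continuous f -> f a = x -> f b = x -> f c = x ->
  seg_cls f a c = (seg_cls f a b * seg_cls f b c)%g.
Proof.
move=> cf fa fb fc; rewrite -cls_concat; try exact: seg_loop.
pose al (s : R) : R := if s - 2^-1 <= 0 then a + (b - a) * (2 * s)
                 else b + (c - b) * (2 * s - 1).
have cal : continuous al.
  apply: cont_paste; [by cont|by cont|by cont|move=> s s2].
  by rewrite (_ : s = 2^-1) ?mulfV //; lra.
have al0 : al 0 = a by rewrite /al ifT; lra.
have al1 : al 1 = c by rewrite /al ifF; [lra|apply/negbTE; lra].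
have := @seg_cls_reparam f al 0 1 cf cal.
rewrite al0 al1 => <- //; rewrite /seg_cls /loop_concat; congr cls.
apply/funext => s; rewrite /al subr_le0 add0r subr0 mul1r.
by case: ifP.
Qed.

Lemma seg_cls_id (f : R -> S) a : continuous f -> f a = x -> seg_cls f a a = 1%g.
Proof.
move=> cf fa; have := @seg_cls_add f a a a cf fa fa fa.
by rewrite -[LHS]mulg1 => /mulgI.
Qed.

Lemma seg_cls_ext (f g : R -> S) a b : a <= b -> continuous f -> continuous g ->
  (forall u, a <= u <= b -> f u = g u) -> f a = x -> f b = x ->
  seg_cls f a b = seg_cls g a b.
Proof.
move=> leab cf cg fg fa fb; apply: cls_ext; try apply: seg_loop => //.
- by rewrite -fg ?lexx.
- by rewrite -fg ?lexx ?leab.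
by move=> s /andP[s0 s1]; apply: fg; apply/andP; split; nra.
Qed.

(** Paths that are not loops are closed up by [tail y], a path from [y] back to
    the base point. *)
Variable tail : S -> R -> S.
Hypothesis cont_tail : forall y, continuous (tail y).
Hypothesis tail_start : forall y u, u <= 0 -> tail y u = y.
Hypothesis tail_end : forall y u, 1 <= u -> tail y u = x.

Local Ltac cont_base ::= exact: cont_tail.

Definition closed_path (p : R -> S) a b u :=
  if u - a <= 0 then tail (p a) (a - u)
  else if u - b <= 0 then p u else tail (p b) (u - b).

(** Classes of paths are elements of [Gamma]: as every point carries a fixed path
    back to the base point, the fundamental groupoid retracts onto [Gamma], and
    [path_cls] is this retraction. *)
Definition path_cls (p : R -> S) a b := seg_cls (closed_path p a b) (a - 1) (b + 1).

Lemma cont_closed_path (p : R -> S) a b :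
  continuous p -> a <= b -> continuous (closed_path p a b).
Proof.
move=> cp leab; apply: cont_paste.
- by cont.
- by cont.
- apply: cont_paste => //; [by cont|by cont|move=> u ub].
  by rewrite ub tail_start //; congr p; lra.
move=> u ua; have -> : u = a by lra.
by rewrite subrr tail_start // ifT // subr_le0.
Qed.

Lemma closed_path_l (p : R -> S) a b : closed_path p a b (a - 1) = x.
Proof. by rewrite /closed_path ifT; [apply: tail_end; lra|lra]. Qed.

Lemma closed_path_r (p : R -> S) a b : a <= b -> closed_path p a b (b + 1) = x.
Proof.
move=> leab; rewrite /closed_path !ifF; [apply: tail_end; lra| |];
  by apply/negbTE; lra.
Qed.

Lemma path_cls_ext (p q : R -> S) a b : continuous p -> continuous q -> a <= b ->
  (forall u, a <= u <= b -> p u = q u) -> path_cls p a b = path_cls q a b.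
Proof.
move=> cp cq leab pq; apply: seg_cls_ext; rewrite ?closed_path_l ?closed_path_r //.
- by lra.
- exact: cont_closed_path.
- exact: cont_closed_path.
move=> u _; rewrite /closed_path (pq a) ?lexx // (pq b) ?lexx ?leab //.
by case: ifP => // ua; case: ifP => // ub; apply: pq; lra.
Qed.

Lemma path_cls_shift (p : R -> S) d a b : continuous p -> a <= b ->
  path_cls (fun u => p (u + d)) a b = path_cls p (a + d) (b + d).
Proof.
move=> cp leab; rewrite /path_cls.
have -> : a + d - 1 = a - 1 + d by lra.
have -> : b + d + 1 = b + 1 + d by lra.
rewrite -(@seg_cls_reparam _ (fun u => u + d)) //.
- congr seg_cls; apply/funext => u; rewrite /closed_path.
  have -> : u + d - (a + d) = u - a by lra.
  have -> : u + d - (b + d) = u - b by lra.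
  by have -> : a + d - (u + d) = a - u by lra.
- by apply: cont_closed_path => //; lra.
- by cont.
- by rewrite (_ : _ + d = a + d - 1) ?closed_path_l //; lra.
- by rewrite (_ : _ + d = b + d + 1) ?closed_path_r //; lra.
Qed.

Lemma path_cls_htpy (P : R * R -> S) a b : continuous P -> a <= b ->
  (forall t, P (a, t) = P (a, 0)) -> (forall t, P (b, t) = P (b, 0)) ->
  path_cls (fun u => P (u, 0)) a b = path_cls (fun u => P (u, 1)) a b.
Proof.
move=> cP leab Pa Pb.
pose H (z : R * R) := if z.1 - a <= 0 then tail (P (a, 0)) (a - z.1)
  else if z.1 - b <= 0 then P z else tail (P (b, 0)) (z.1 - b).
have cH : continuous H.
  apply: cont_paste; [by cont|by cont| |].
    apply: cont_paste => //; [by cont|by cont|].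
    move=> [u t] /= ub; rewrite ub tail_start // (_ : u = b) //; lra.
  move=> [u t] /= ua; have -> : u = a by lra.
  by rewrite subrr tail_start // ifT // subr_le0.
have := @seg_cls_htpy H (a - 1) (b + 1) cH.
rewrite /path_cls /closed_path /H /= (Pa 1) (Pb 1) => -> //.
- by move=> t; rewrite ifT; [apply: tail_end; lra|lra].
- by move=> t; rewrite !ifF; [apply: tail_end; lra| |]; apply/negbTE; lra.
Qed.

(** Between two consecutive paths the tail at the common end point is run
    through back and forth; this excursion is contracted by cutting it off at
    height [1 - t]. *)
Lemma path_cls_add (p : R -> S) a b c : continuous p -> a <= b -> b <= c ->
  path_cls p a c = (path_cls p a b * path_cls p b c)%g.
Proof.
move=> cp leab lebc.
pose L u := if u - a <= 0 then tail (p a) (a - u) else p u.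
pose M u := if u - c <= 0 then p u else tail (p c) (u - c).
pose spike (z : R * R) := tail (p b) (Num.min (1 - `|z.1 - b - 1|) (1 - z.2)).
pose H (z : R * R) := if z.1 - b <= 0 then L z.1
  else if z.1 - (b + 2) <= 0 then spike z else M (z.1 - 2).
have cL : continuous L.
  apply: cont_paste => //; [by cont|by cont|].
  by move=> u ua; rewrite tail_start; [congr p|]; lra.
have cM : continuous M.
  apply: cont_paste => //; [by cont|by cont|].
  by move=> u ua; rewrite ua tail_start //; congr p; lra.
have cH : continuous H.
  apply: cont_paste; [by cont|by cont| |].
    apply: cont_paste; [by cont|by rewrite /spike; cont|by cont|].
    move=> [u t] /= ub; rewrite /spike /M /= tail_start.
      by rewrite ifT; [congr p|]; lra.
    by rewrite ge_min ger0_norm; lra.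
  move=> [u t] /= ub; rewrite /L /spike /= [in RHS]ifT; last by lra.
  rewrite [RHS]tail_start; last by rewrite ge_min ler0_norm; lra.
  case: ifP => ua; last by congr p; lra.
  by rewrite tail_start; [congr p|]; lra.
have Hl t : H (a - 1, t) = x.
  by rewrite /H /L /= !ifT ?tail_end //; lra.
have Hr t : H (c + 3, t) = x.
  rewrite /H /M /= !ifF ?tail_end //; first lra; apply/negbTE; lra.
have Hm : H (b + 1, 0) = x.
  rewrite /H /spike /= ifF; last by apply/negbTE; lra.
  rewrite ifT ?tail_end //; last by lra.
  by rewrite le_min (_ : b + 1 - b - 1 = 0) ?normr0; lra.
have := seg_cls_htpy cH Hl Hr.
rewrite (@seg_cls_add _ _ (b + 1)) //; last by cont.
have -> : seg_cls (fun s => H (s, 0)) (a - 1) (b + 1) = path_cls p a b.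
  apply: seg_cls_ext => //; [lra|by cont|exact: cont_closed_path|].
  move=> u u_in; rewrite /H /closed_path /L /spike /=.
  case: ifP => ub; first by case: ifP => // ua; rewrite ub.
  rewrite ifT; last by lra.
  rewrite ifF; last by apply/negbTE; lra.
  by congr tail; rewrite min_l ler0_norm; lra.
have -> : seg_cls (fun s => H (s, 0)) (b + 1) (c + 3) = path_cls p b c.
  rewrite /path_cls (_ : b - 1 = b + 1 - 2); last by lra.
  rewrite (_ : c + 1 = c + 3 - 2); last by lra.
  rewrite -(@seg_cls_reparam _ (fun u => u - 2)); first 1 last.
  - exact: cont_closed_path.
  - by cont.
  - by rewrite (_ : _ - 2 = b - 1) ?closed_path_l //; lra.
  - by rewrite (_ : _ - 2 = c + 1) ?closed_path_r //; lra.
  apply: seg_cls_ext => //; [lra|by cont| |].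
    by apply: (cont_comp (cont_closed_path cp lebc)); cont.
  move=> u u_in; rewrite /H /closed_path /M /spike /=.
  rewrite ifF; last by apply/negbTE; lra.
  have -> : (u - 2 - b <= 0) = (u - (b + 2) <= 0) by congr (_ <= _); lra.
  case: ifP => // ub.
  by congr tail; rewrite min_l ger0_norm; lra.
move->.
pose be u : R := Num.min u (Num.max b (u - 2)).
have bea : be (a - 1) = a - 1 by rewrite /be min_l // le_max; lra.
have bec : be (c + 3) = c + 1.
  by rewrite /be max_r ?min_r; lra.
rewrite /path_cls -[in LHS]bea -[in LHS]bec -(@seg_cls_reparam _ be); first 1 last.
- by apply: cont_closed_path => //; lra.
- by rewrite /be; cont.
- by rewrite bea closed_path_l.
- by rewrite bec closed_path_r //; lra.
apply: seg_cls_ext => //; [lra| |by cont| | |].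
- by apply: (cont_comp (cont_closed_path cp (le_trans leab lebc))); rewrite /be; cont.
- move=> u _; symmetry; rewrite /H /L /M /spike /closed_path /=.
  case: ifP => ub.
    have -> : be u = u by rewrite /be min_l // le_max -subr_le0 ub.
    by case: ifP => // ua; rewrite ifT //; lra.
  case: ifP => ub2.
    have -> : be u = b by rewrite /be max_l ?min_r; lra.
    rewrite [LHS]tail_start; last by rewrite ge_min subrr lexx orbT.
    case: ifP => ab; last by rewrite ifT //; lra.
    by rewrite tail_start; [congr p|]; lra.
  have -> : be u = u - 2 by rewrite /be max_r ?min_r; lra.
  by rewrite [in RHS]ifF //; apply/negbTE; lra.
- by rewrite bea closed_path_l.
- by rewrite bec closed_path_r //; lra.
Qed.

Lemma path_cls_id (p : R -> S) a : continuous p -> path_cls p a a = 1%g.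
Proof.
move=> cp; have := @path_cls_add p a a a cp (lexx a) (lexx a).
by rewrite -[LHS]mulg1 => /mulgI.
Qed.

(** The closed path of a constant path is a reparametrization of that of a
    constant path over a point. *)
Lemma path_cls_cst (y : S) a b : a <= b -> path_cls (fun _ => y) a b = 1%g.
Proof.
move=> leab; have cy : continuous (fun _ : R => y) by cont.
rewrite -(@path_cls_id (fun _ => y) 0) // /path_cls.
pose al (u : R) : R := Num.min (u - a) 0 + Num.max (u - b) 0.
have ala : al (a - 1) = 0 - 1 by rewrite /al min_l ?max_r; lra.
have alb : al (b + 1) = 0 + 1 by rewrite /al min_r ?max_l; lra.
rewrite -{1}ala -[in RHS]alb -(@seg_cls_reparam _ al); first 1 last.
- exact: cont_closed_path.
- by rewrite /al; cont.
- by rewrite ala closed_path_l.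
- by rewrite alb closed_path_r.
congr seg_cls; apply/funext => u; rewrite /closed_path.
case: ifP => ua.
  have -> : al u = u - a by rewrite /al min_l ?max_r; lra.
  by rewrite ifT; [congr tail|]; lra.
case: ifP => ub.
  have -> : al u = 0 by rewrite /al min_r ?max_r; lra.
  by rewrite subrr lexx tail_start.
have -> : al u = u - b by rewrite /al min_r ?max_l; lra.
by rewrite !ifF; [congr tail| |]; lra.
Qed.

Lemma path_cls_rescale (p : R -> S) a b : continuous p -> a < b ->
  path_cls p a b = path_cls (fun s => p (a + (b - a) * s)) 0 1.
Proof.
move=> cp ltab; pose al (u : R) : R :=
  Num.min (u - a) 0 + clamp ((u - a) / (b - a)) + Num.max (u - b) 0.
have ab_gt0 : 0 < b - a by lra.
have al_lo u : u - a <= 0 -> al u = u - a.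
  move=> ua; have -> : al u = u - a + 0 + 0; last by rewrite !addr0.
  congr (_ + _ + _); first by rewrite min_l.
    by rewrite clamp_le0 // mulr_le0_ge0 // invr_ge0 ltW.
  by rewrite max_r //; lra.
have al_hi u : 0 <= u - b -> al u = u - b + 1.
  move=> ub; have -> : al u = 0 + 1 + (u - b); last by lra.
  congr (_ + _ + _); first by rewrite min_r //; lra.
    by rewrite clamp_ge1 // ler_pdivlMr // mul1r; lra.
  by rewrite max_l.
have al_mid u : 0 <= u - a -> u - b <= 0 -> al u = (u - a) / (b - a).
  move=> ua ub; have -> : al u = 0 + (u - a) / (b - a) + 0; last by lra.
  congr (_ + _ + _); first by rewrite min_r.
    by rewrite clamp_id // divr_ge0 ?(ltW ab_gt0) //= ler_pdivrMr // mul1r; lra.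
  by rewrite max_r.
have ala : al (a - 1) = 0 - 1 by rewrite al_lo; lra.
have alb : al (b + 1) = 1 + 1 by rewrite al_hi; lra.
have cq : continuous (fun s => p (a + (b - a) * s)) by cont.
rewrite /path_cls -[in RHS]ala -[in RHS]alb -(@seg_cls_reparam _ al); first 1 last.
- exact: cont_closed_path.
- by rewrite /al; cont.
- by rewrite ala closed_path_l.
- by rewrite alb closed_path_r.
have p0 : a + (b - a) * 0 = a by lra.
have p1 : a + (b - a) * 1 = b by lra.
congr seg_cls; apply/funext => u; rewrite /closed_path p0 p1.
case: ifP => ua; first by rewrite al_lo // ifT; [congr tail|]; lra.
case: ifP => ub.
  rewrite al_mid //; last by lra.
  have u_gt0 : 0 < (u - a) / (b - a) by rewrite divr_gt0 //; lra.
  rewrite ifF; last by apply/negbTE; rewrite subr0 -ltNge.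
  rewrite ifT; last by rewrite subr_le0 ler_pdivrMr // mul1r; lra.
  by congr p; rewrite mulrCA mulfV ?gt_eqF // mulr1; lra.
by rewrite al_hi ?ifF; [congr tail| | |]; lra.
Qed.

(** The two ways around the square are homotopic since the square is convex. *)
Lemma square_path_cls (h : R * R -> S) : continuous h ->
  (path_cls (fun s => h (s, 0%R)) 0 1 * path_cls (fun t => h (1%R, t)) 0 1
   = path_cls (fun t => h (0%R, t)) 0 1 * path_cls (fun s => h (s, 1%R)) 0 1)%g.
Proof.
move=> ch.
pose lo (u : R) : R := Num.min u 1.
pose hi (u : R) : R := Num.max (u - 1) 0.
have clo : continuous lo by rewrite /lo; cont.
have chi : continuous hi by rewrite /hi; cont.
have lo01 u : 0 <= u <= 1 -> lo u = u by move=> u01; rewrite /lo min_l //; lra.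
have hi01 u : 0 <= u <= 1 -> hi u = 0 by move=> u01; rewrite /hi max_r //; lra.
have lo12 u : 0 <= u <= 1 -> lo (u + 1) = 1.
  by move=> u01; rewrite /lo min_r //; lra.
have hi12 u : 0 <= u <= 1 -> hi (u + 1) = u.
  by move=> u01; rewrite /hi max_l addrK //; lra.
have corner (g1 g2 : R -> R) : continuous g1 -> continuous g2 ->
    path_cls (fun u => h (g1 u, g2 u)) 0 2 =
    (path_cls (fun u => h (g1 u, g2 u)) 0 1
     * path_cls (fun u => h (g1 (u + 1)%R, g2 (u + 1)%R)) 0 1)%g.
  move=> c1 c2; have cg : continuous (fun u => h (g1 u, g2 u)) by cont.
  rewrite (@path_cls_add _ 0 1 2) //; last by lra.
  congr (_ * _)%g.
  rewrite (@path_cls_shift (fun u => h (g1 u, g2 u)) 1 0 1) //.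
  by rewrite add0r.
transitivity (path_cls (fun u => h (lo u, hi u)) 0 2).
  rewrite corner //; congr (_ * _)%g; apply: path_cls_ext => //; try by cont.
  - by move=> u u01; rewrite lo01 ?hi01.
  - by move=> u u01; rewrite lo12 ?hi12.
transitivity (path_cls (fun u => h (hi u, lo u)) 0 2); last first.
  rewrite corner //; congr (_ * _)%g; apply: path_cls_ext => //; try by cont.
  - by move=> u u01; rewrite lo01 ?hi01.
  - by move=> u u01; rewrite lo12 ?hi12.
pose P (z : R * R) := h ((1 - z.2) * lo z.1 + z.2 * hi z.1,
                         (1 - z.2) * hi z.1 + z.2 * lo z.1).
have cP : continuous P by rewrite /P; cont.
have lo0 : lo 0 = 0 by rewrite /lo min_l //; lra.
have hi0 : hi 0 = 0 by rewrite /hi max_r //; lra.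
have lo2 : lo 2 = 1 by rewrite /lo min_r //; lra.
have hi2 : hi 2 = 1 by rewrite /hi max_l //; lra.
have := @path_cls_htpy P 0 2 cP.
rewrite /P /=; under eq_fun do rewrite subr0 !mul1r !mul0r !addr0.
under [in RHS]eq_fun do rewrite subrr !mul1r !mul0r !add0r.
apply; first lra.
- by move=> t; rewrite lo0 hi0; congr (h (_, _)); lra.
- by move=> t; rewrite lo2 hi2; congr (h (_, _)); lra.
Qed.

End Loops.

(** * Spaces glued from a square along affine pieces *)

Section AffineGluing.
Local Open Scope ring_scope.
Variable R : realType.
Implicit Types z w : R * R.

Definition unit_square : set (R * R) := [set z | 0 <= z.1 <= 1 /\ 0 <= z.2 <= 1].

Lemma unit_square_seg z w t :
  unit_square z -> unit_square w -> 0 <= t <= 1 -> unit_square (seg z w t).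
Proof. by move=> [z1 z2] [w1 w2] t01; split => /=; apply/andP; split; nra. Qed.

Lemma seg0 z w : seg z w 0 = z.
Proof. by case: z => z1 z2; rewrite /seg subr0 !mul1r !mul0r !addr0. Qed.

Lemma seg1 z w : seg z w 1 = w.
Proof. by case: w => w1 w2; rewrite /seg subrr !mul1r !mul0r !add0r. Qed.

Lemma segxx z t : seg z z t = z.
Proof. by case: z => z1 z2; rewrite /seg -!mulrDl subrK !mul1r. Qed.

Lemma compact_unit_square : compact unit_square.
Proof.
have -> : unit_square = `[0, 1]%classic `*` `[0, 1]%classic.
  by apply/seteqP; split=> z; rewrite /unit_square /= !in_itv.
by apply: compact_setX; exact: segment_compact.
Qed.

(** A space glued from the unit square: the graph of the equivalence relation
    on the square is a finite union of pieces
    [{(left_of j t, right_of j t) | t in unit_square}] that are affine images of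
    the square, hence compact and convex, and that are graphs of partial
    functions.  The last field says that the fibres of the projection vary upper
    semicontinuously. *)
Record affine_gluing (S : topologicalType) := AffineGluing {
  proj : R * R -> S;
  piece : finType;
  left_of : piece -> R * R -> R * R;
  right_of : piece -> R * R -> R * R;
  proj_cont : continuous proj;
  proj_surj : forall y, exists2 z, unit_square z & proj z = y;
  left_cont : forall j, continuous (left_of j);
  right_cont : forall j, continuous (right_of j);
  left_seg : forall j z w t, left_of j (seg z w t) = seg (left_of j z) (left_of j w) t;
  right_seg : forall j z w t,
    right_of j (seg z w t) = seg (right_of j z) (right_of j w) t;
  proj_fibre : forall z w, unit_square z -> unit_square w ->
    (proj z = proj w <->
     exists j, exists2 t, unit_square t & z = left_of j t /\ w = right_of j t);
  left_in : forall j t, unit_square t -> unit_square (left_of j t);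
  right_in : forall j t, unit_square t -> unit_square (right_of j t);
  piece_fun : forall j t t', unit_square t -> unit_square t' ->
    left_of j t = left_of j t' -> right_of j t = right_of j t';
  fibre_usc : forall y (V : set (R * R)), open V ->
    (forall z, unit_square z -> proj z = y -> V z) ->
    \forall y' \near y, forall z, unit_square z -> proj z = y' -> V z
}.

Lemma common_radius (T : choiceType) (A : set T) (P : T -> R -> Prop) :
  finite_set A ->
  (forall a e e', 0 < e' <= e -> P a e -> P a e') ->
  (forall a, A a -> exists2 e, 0 < e & P a e) ->
  exists2 e, 0 < e & forall a, A a -> P a e.
Proof.
move=> /finite_seqP[s ->] mono; elim: s => [|a s IHs] Pe.
  by exists 1.
have [e1 e1_gt0 Pa] := Pe a (mem_head _ _).
have [|e2 e2_gt0 Ps] := IHs; first by move=> b bs; apply: Pe; rewrite /= inE bs orbT.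
exists (Num.min e1 e2); first by rewrite lt_min e1_gt0.
have lem : 0 < Num.min e1 e2 by rewrite lt_min e1_gt0.
move=> b /=; rewrite inE => /predU1P[->|bs].
  by apply: mono Pa; rewrite lem ge_min lexx.
by apply: mono (Ps b bs); rewrite lem ge_min lexx orbT.
Qed.

Section Fibres.
Variables (S : topologicalType) (D : affine_gluing S).
Local Notation q := (proj D).

(** Fibres are taken in the square, although [proj] is defined on the plane. *)
Definition fibre (y : S) : set (R * R) := [set z | unit_square z /\ q z = y].

Lemma finite_fibre y : finite_set (fibre y).
Proof.
have [z0 Qz0 qz0] := proj_surj D y.
pose g (j : piece D) := right_of j (get [set t | unit_square t /\ left_of j t = z0]).
apply: (@sub_finite_set _ _ (range g)); last exact: finite_image.
move=> w [Qw qw].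
have [|j [t Qt [zE wE]]] := (proj_fibre D Qz0 Qw).1; first by rewrite qz0.
exists j => //; rewrite wE /g.
have [Qu uE] : [set t | unit_square t /\ left_of j t = z0]
    (get [set t | unit_square t /\ left_of j t = z0]).
  by apply: (@getPex _ [set t | unit_square t /\ left_of j t = z0]); exists t.
by apply: piece_fun; rewrite ?uE.
Qed.

Lemma piece_closed (j : piece D) :
  closed [set (left_of j t, right_of j t) | t in unit_square].
Proof.
apply: compact_closed.
  exact: norm_hausdorff.
apply: continuous_compact compact_unit_square.
apply: continuous_subspaceT; apply: cont_pair.
  exact: left_cont.
exact: right_cont.
Qed.

(** Close to a pair of points of the same fibre, the equivalence relation only
    involves pieces that contain this pair; as fibres are finite, one radius
    serves all pairs. *)
Lemma local_pieces x : exists2 e, 0 < e &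
  forall z z' w w', fibre x z -> fibre x z' -> unit_square w -> unit_square w' ->
    q w = q w' -> ball z e w -> ball z' e w' ->
    exists (j : piece D) t t', [/\ unit_square t /\ unit_square t',
      z = left_of j t, z' = right_of j t,
      w = left_of j t' & w' = right_of j t'].
Proof.
pose C (j : piece D) := [set (left_of j t, right_of j t) | t in unit_square].
pose P (a : (R * R) * (R * R) * piece D) e := ~ C a.2 a.1 ->
  forall b, ball a.1 e b -> ~ C a.2 b.
have [] := @common_radius _ ((fibre x `*` fibre x) `*` setT) P.
- by apply: finite_setX; [apply: finite_setX; exact: finite_fibre|exact: finite_finset].
- move=> a e e' /andP[_ lee] Pa nCa w /(le_ball lee); exact: Pa.
- move=> [a j] _; have [Ca|nCa] := pselect (C j a).
    by exists 1 => // /(_ Ca).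
  have : nbhs a (~` C j).
    by apply: open_nbhs_nbhs; split => //; apply: closed_openC; exact: piece_closed.
  by move=> /nbhs_ballP[e /= e_gt0 eC]; exists e => // _ w /eC.
move=> e e_gt0 Pe; exists e => // z z' w w' xz xz' Qw Qw' qww' zw zw'.
have [j [t' Qt' [wE w'E]]] := (proj_fibre D Qw Qw').1 qww'.
have [[t Qt [zE z'E]]|nC] := pselect (C j (z, z')).
  by exists j, t, t'.
exfalso; apply: (Pe ((z, z'), j) _ nC (w, w')) => //.
by exists t'; rewrite // wE w'E.
Qed.

End Fibres.
End AffineGluing.

Ltac cont_base ::=
  first [exact: proj_cont | exact: left_cont | exact: right_cont].

(** * The developing map and generation of the fundamental group *)

Section DevelopingMap.
Local Open Scope ring_scope.
Variables (R : realType) (S : topologicalType) (x : S) (Gamma : groupType).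
Variable cls : (R -> S) -> Gamma.
Hypothesis cls_homotopic : forall p q, is_loop x p -> is_loop x q ->
  (cls p = cls q <-> loop_homotopic x p q).
Hypothesis cls_concat : forall p q, is_loop x p -> is_loop x q ->
  cls (loop_concat p q) = (cls p * cls q)%g.
Variable D : affine_gluing R S.
Local Notation q := (proj D).

Definition section (y : S) : R * R := s2val (cid2 (proj_surj D y)).

Lemma sectionP y : fibre D y (section y).
Proof. by rewrite /section; case: cid2. Qed.

Definition tail (y : S) (u : R) : S := q (seg (section y) (section x) (clamp u)).

Lemma cont_tail y : continuous (tail y).
Proof.
by rewrite /tail; cont.
Qed.

Lemma tail_start y u : u <= 0 -> tail y u = y.
Proof. by move=> u0; rewrite /tail clamp_le0 // seg0; case: (sectionP y). Qed.

Lemma tail_end y u : 1 <= u -> tail y u = x.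
Proof. by move=> u1; rewrite /tail clamp_ge1 // seg1; case: (sectionP x). Qed.

Local Notation pcls := (path_cls cls tail).
Let pcls_add := path_cls_add cls_homotopic cls_concat cont_tail tail_start tail_end.
Let pcls_cst := path_cls_cst cls_homotopic cls_concat cont_tail tail_start tail_end.
Let pcls_ext := path_cls_ext cls_homotopic cont_tail tail_start tail_end.
Let pcls_rescale := path_cls_rescale cls_homotopic cont_tail tail_start tail_end.
Let pcls_square := square_path_cls cls_homotopic cls_concat cont_tail tail_start tail_end.

(** In the square a path is determined up to homotopy by its end points, so this
    function determines the classes of the images of all paths, see
    [pcls_proj]. *)
Definition develop (z : R * R) : Gamma := pcls (fun s => q (seg (section x) z s)) 0 1.

Lemma pcls_proj (gam : R -> R * R) : continuous gam ->
  pcls (fun s => q (gam s)) 0 1 = ((develop (gam 0))^-1 * develop (gam 1%R))%g.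
Proof.
move=> cgam; apply: (mulgI (develop (gam 0))); rewrite mulVKg.
pose h (z : R * R) := q (seg (section x) (gam z.1) z.2).
have ch : continuous h by rewrite /h; cont.
have := pcls_square ch; rewrite /h /=.
under eq_fun do rewrite seg0.
under [in X in _ = (_ * X)%g -> _]eq_fun do rewrite seg1.
by rewrite pcls_cst ?mul1g // => <-.
Qed.

Lemma develop_section : develop (section x) = 1%g.
Proof.
rewrite /develop; under eq_fun do rewrite segxx.
by rewrite pcls_cst.
Qed.

(** Straight segments on the two sides of a piece have the same image. *)
Lemma develop_piece (j : piece D) t t' : unit_square t -> unit_square t' ->
  (develop (left_of j t) * (develop (right_of j t))^-1
   = develop (left_of j t') * (develop (right_of j t'))^-1)%g.
Proof.
move=> Qt Qt'.
have cseg : continuous (fun s => seg t t' s) by cont.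
have := pcls_proj (cont_comp (@left_cont _ _ D j) cseg).
have := pcls_proj (cont_comp (@right_cont _ _ D j) cseg).
rewrite !seg0 !seg1.
have -> : pcls (fun s => q (left_of j (seg t t' s))) 0 1
        = pcls (fun s => q (right_of j (seg t t' s))) 0 1.
  apply: pcls_ext => //.
  - by cont.
  - by cont.
  move=> u u01; have Qu := unit_square_seg Qt Qt' u01.
  apply/proj_fibre; [exact: left_in|exact: right_in|].
  by exists j; exists (seg t t' u).
move=> -> eqd; apply: (mulgI (develop (left_of j t))^-1%g).
rewrite !mulgA mulVg mul1g -eqd.
by rewrite -!mulgA mulgV mulg1.
Qed.

(** Contracting points along straight segments towards a fixed fibre respects the
    gluing, because pieces are convex. *)
Lemma local_seg y : exists2 e, 0 < e &
  forall z z' w w', fibre D y z -> fibre D y z' ->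
    unit_square w -> unit_square w' -> q w = q w' ->
    ball z e w -> ball z' e w' ->
    forall t, 0 <= t <= 1 -> q (seg w z t) = q (seg w' z' t).
Proof.
have [e e_gt0 He] := local_pieces D y; exists e => // z z' w w' yz yz' Qw Qw' qw zw zw' t t01.
have [j [u [u' [[Qu Qu'] -> -> -> ->]]]] := He _ _ _ _ yz yz' Qw Qw' qw zw zw'.
rewrite -left_seg -right_seg; have Qs := unit_square_seg Qu' Qu t01.
apply/proj_fibre; [exact: left_in|exact: right_in|].
by exists j; exists (seg u' u t).
Qed.

Definition tube (y : S) (e : R) : set S :=
  [set y' | forall z, fibre D y' z -> exists2 w, fibre D y w & ball w e z].

Lemma near_tube y e : 0 < e -> \forall y' \near y, tube y e y'.
Proof.
move=> e0; pose V := \bigcup_(w in fibre D y) ball w e.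
have oV : open V by apply: bigcup_open => w _; exact: ball_open.
have := @fibre_usc _ _ D y V oV.
move=> /(_ _)/filterS; apply.
  by move=> y' VP z [Qz qz]; have [w yw zw] := VP z Qz qz; exists w.
by move=> z Qz qz; exists z => //; exact: ballxx.
Qed.

(** Every point has a neighbourhood [U] in which each path can be contracted to
    that point, its end points moving along images of straight segments of the
    square.  Hence the class of a path in [U] is known from its end points. *)
Lemma pcls_small y : exists2 U : set S, nbhs y U &
  forall p : R -> S, continuous p -> (forall s, 0 <= s <= 1 -> U (p s)) ->
  exists z z', [/\ fibre D y z, fibre D y z' &
    pcls p 0 1 = ((develop (section (p 0)))^-1 * develop z
                  * (develop z')^-1 * develop (section (p 1%R)))%g].
Proof.
have [e e0 He] := local_seg y.
exists (tube y e) => [|p cp Up]; first exact: near_tube.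
pose c w := get [set z | fibre D y z /\ ball z e w].
have cP y' w : tube y e y' -> fibre D y' w -> fibre D y (c w) /\ ball (c w) e w.
  move=> Uy' yw; have [z yz zw] := Uy' w yw.
  by apply: (@getPex _ [set z | fibre D y z /\ ball z e w]); exists z.
have Uc s : tube y e (p (clamp s)) by apply: Up; exact: clamp_in.
have cS s := cP _ _ (Uc s) (sectionP (p (clamp s))).
(* The chosen lift [w] is not continuous in [z], but by [local_seg] the image
   of the contracted point does not depend on the lift. *)
pose h (z : R * R) := let w := section (p (clamp z.1)) in q (seg w (c w) (clamp z.2)).
have ch : continuous h.
  move=> [s0 t0] N Nh; pose y0 := p (clamp s0).
  have [||eta eta0 Heta] := @common_radius R _ (fibre D y0)
      (fun w eta => (forall w1 t, ball w eta w1 -> ball t0 eta t ->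
                       N (q (seg w1 (c w) (clamp t)))) /\
                    (forall w1, ball w eta w1 -> ball (c w) e w1)) (finite_fibre D y0).
  - move=> w e1 e2 /andP[_ e21] [H1 H2]; split=> w1; last by move=> /(le_ball e21)/H2.
    by move=> t /(le_ball e21) + /(le_ball e21); exact: H1.
  - move=> w y0w; have [yc cw] := cP _ _ (Uc s0) y0w.
    pose g (z : (R * R) * R) := q (seg z.1 (c w) (clamp z.2)).
    have cg : continuous g by rewrite /g; cont.
    have gw : g (w, t0) = h (s0, t0).
      have [yc0 c0] := cS s0; have [Qw qw] := y0w; have [Q0 q0] := sectionP y0.
      by apply: He => //; rewrite ?qw ?q0 //; exact: clamp_in.
    have /nbhs_ballP[e1 /= e1_gt0 He1] : nbhs (w, t0) (g @^-1` N).
      by apply: cg; rewrite gw.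
    have /nbhs_ballP[e2 /= e2_gt0 He2] : nbhs w (ball (c w) e).
      by apply: open_nbhs_nbhs; split => //; exact: ball_open.
    exists (Num.min e1 e2); first by rewrite lt_min e1_gt0.
    have [le1 le2] : Num.min e1 e2 <= e1 /\ Num.min e1 e2 <= e2.
      by rewrite !ge_min !lexx orbT.
    split=> w1 => [t|] w_w1; last exact/He2/(le_ball le2).
    by move=> t0t; apply: (He1 (w1, t)); split; apply: (le_ball le1).
  have near_s : \forall s \near s0, tube y0 eta (p (clamp s)).
    have cpc : continuous (fun s => p (clamp s)) by cont.
    by apply: cpc; exact: near_tube.
  exists ([set s | tube y0 eta (p (clamp s))], ball t0 eta).
    by split => //=; exact: nbhsx_ballx.
  move=> [s t] /= [ys t0t].
  have [w y0w w_s] := ys _ (sectionP _).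
  have [/(_ _ _ w_s t0t) + /(_ _ w_s) c_s] := Heta w y0w.
  have [yc _] := cP _ _ (Uc s0) y0w; have [ycs cs] := cS s.
  have [Qs qs] := sectionP (p (clamp s)).
  rewrite /h /= (He (c w) (c (section (p (clamp s)))) _ (section (p (clamp s)))) //.
  exact: clamp_in.
have clamp0 : clamp (0 : R) = 0 by exact: clamp_le0.
have clamp1 : clamp (1 : R) = 1 by exact: clamp_ge1.
have bottom : pcls (fun s => h (s, 0)) 0 1 = pcls p 0 1.
  have -> : (fun s => h (s, 0)) = (fun s => p (clamp s)).
    apply/funext => s; rewrite /h /= clamp0 seg0.
    by case: (sectionP (p (clamp s))).
  apply: pcls_ext => //; first by cont.
  by move=> u u01; rewrite clamp_id.
have top : pcls (fun s => h (s, 1)) 0 1 = 1%g.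
  have -> : (fun s => h (s, 1)) = (fun=> y).
    by apply/funext => s; rewrite /h /= clamp1 seg1; have [[]] := cS s.
  exact: pcls_cst.
have side s : pcls (fun t => h (s, t)) 0 1
    = ((develop (section (p (clamp s))))^-1
       * develop (c (section (p (clamp s)))))%g.
  set w := section _.
  have := @pcls_proj (fun t => seg w (c w) (clamp t)).
  rewrite clamp0 clamp1 seg0 seg1.
  by move=> <- //; cont.
have [yc0 _] := cS 0; have [yc1 _] := cS 1.
rewrite clamp0 in yc0; rewrite clamp1 in yc1.
exists (c (section (p 0))), (c (section (p 1))); split => //.
have := etrans (esym (congr2 _ bottom (side 1)))
  (etrans (pcls_square ch) (congr2 _ (side 0) top)).
rewrite clamp0 clamp1; by rewrite mulg1 => /(canRL (mulgK _)) ->; rewrite invgM invgK !mulgA.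
Qed.

Lemma pcls_loop (p : R -> S) : continuous p -> p 0 = x -> p 1 = x ->
  pcls p 0 1 = cls p.
Proof.
move=> cp p0 p1; pose W := closed_path tail p 0 1.
have cW : continuous W by apply: cont_closed_path => //; [exact: cont_tail|exact: tail_start].
have W0 u : u <= 0 -> W u = x.
  move=> u0; rewrite /W /closed_path p0 subr0 u0 sub0r /tail segxx.
  by case: (sectionP x).
have W1 u : 1 <= u -> W u = x.
  move=> u1; rewrite /W /closed_path p1 /tail segxx ifF; last by apply/negbTE; lra.
  case: ifP => u1'; last by case: (sectionP x).
  by rewrite -[RHS]p1; congr p; lra.
have cst a b : a <= b -> (forall u, a <= u <= b -> W u = x) ->
    seg_cls cls W a b = 1%g.
  move=> leab Wx; have cx : continuous (fun _ : R => x) by cont.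
  rewrite (@seg_cls_ext _ _ _ _ _ cls_homotopic _ (fun _ => x)) ?Wx ?lexx ?leab //.
  exact: (seg_cls_id cls_homotopic cls_concat (a := 0) cx erefl).
have add := seg_cls_add cls_homotopic cls_concat cW.
have Wl : W (0 - 1) = x by apply: W0; lra.
have Wr : W (1 + 1) = x by apply: W1; lra.
have {}W00 : W 0 = x by exact: W0.
have {}W11 : W 1 = x by exact: W1.
rewrite /path_cls -/W (add _ 0 _ Wl W00 Wr) (add 0 1 _ W00 W11 Wr).
rewrite cst; [|lra|by move=> u u01; apply: W0; lra].
rewrite [X in (_ * (_ * X))%g]cst; [|lra|by move=> u u01; apply: W1; lra].
rewrite mul1g mulg1 (@seg_cls_ext _ _ _ _ _ cls_homotopic _ p) //.
  by rewrite /seg_cls; under eq_fun do rewrite add0r subr0 mul1r.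
move=> u u01; rewrite /W /closed_path; case: ifP => u0.
  have -> : u = 0 by lra.
  by rewrite p0 tail_start // subrr.
by rewrite ifT //; lra.
Qed.

Hypothesis cls_surj : forall c : Gamma, exists2 p, is_loop x p & cls p = c.

Definition transition : set Gamma := [set g | exists w w',
  [/\ unit_square w, unit_square w', q w = q w'
    & g = (develop w * (develop w')^-1)%g]].

(** A loop is cut into short paths; by [pcls_small] each of these contributes a
    product of transitions, once it is closed up along straight segments. *)
Theorem transitions_generate : generates transition.
Proof.
move=> P [P1 PM PV] trP g; have [p0 lp0 <-] := cls_surj g.
have [cp0 p00 p01] := lp0; pose p s := p0 (clamp s).
have cp : continuous p.
  apply: (continuous_retract cp0 (cont_clamp (f := id) _)); first by cont.
  by move=> u; rewrite /= in_itv /= clamp_in.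
have px0 : p 0 = x by rewrite /p clamp_id // lexx ler01.
have px1 : p 1 = x by rewrite /p clamp_id // lexx ler01.
rewrite (@cls_ext _ _ _ _ _ cls_homotopic p0 p) //; first last.
- by move=> s s01; rewrite /p clamp_id.
- exact: continuous_is_loop.
rewrite -pcls_loop //.
have same y w w' : fibre D y w -> fibre D y w' -> P (develop w * (develop w')^-1)%g.
  by move=> [Qw qw] [Qw' qw']; apply: trP; exists w, w'; rewrite qw qw'.
suff Pp : forall w w', fibre D (p 0) w -> fibre D (p 1) w' ->
    P (develop w * pcls p 0 1 * (develop w')^-1)%g.
  have := Pp (section x) (section x).
  by rewrite px0 px1 develop_section invg1 mul1g mulg1; apply; exact: sectionP.
apply: (interval_induction (P := fun a b => forall w w', fibre D (p a) w ->
  fibre D (p b) w' -> P (develop w * pcls p a b * (develop w')^-1)%g)).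
  move=> a b c leab lebc Pab Pbc w w' aw cw'.
  have bs := sectionP (p b).
  have := PM _ _ (Pab _ _ aw bs) (Pbc _ _ bs cw').
  by rewrite (@pcls_add _ a b c) // !mulgA mulgVK.
move=> t t01; have [U Ut HU] := pcls_small (p t).
have /nbhs_ballP[e /= e0 He] : nbhs t (p @^-1` U) by exact: cp.
exists e => // a b a0 b1 /andP[leat letb] ta bt w w' aw bw'.
have [ltab|leba] := ltP a b; last first.
  have eqab : b = a by lra.
  rewrite eqab in bw' *.
  rewrite (path_cls_id cls_homotopic cls_concat cont_tail tail_start tail_end) //.
  by rewrite mulg1; exact: same aw bw'.
rewrite pcls_rescale //.
have [||z [z' [tz tz' ->]]] := HU (fun s => p (a + (b - a) * s)).
- by cont.
- move=> s s01; apply: He; rewrite /ball /= ltr_norml; apply/andP; split; nra.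
rewrite mulr0 addr0 mulr1 subrKC.
have := PM _ _ (PM _ _ (same _ _ _ aw (sectionP _)) (same _ _ _ tz tz'))
  (same _ _ _ (sectionP _) bw').
by rewrite !mulgA.
Qed.

End DevelopingMap.

(** * Local systems on a glued space *)

Section LocalSystem.
Local Open Scope ring_scope.
Variables (R : realType) (S : topologicalType) (D : affine_gluing R S).
Local Notation q := (proj D).
Variables (H : groupType) (lam : R * R -> H).
Hypothesis lam_piece : forall (j : piece D) t t', unit_square t -> unit_square t' ->
  (lam (left_of j t) * (lam (right_of j t))^-1
   = lam (left_of j t') * (lam (right_of j t'))^-1)%g.

(** Inside this radius the equivalence relation near the fibre of [y] is
    described by the pieces through pairs of points of that fibre. *)
Definition radius (y : S) : R := s2val (cid2 (local_pieces D y)).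

Lemma radius_gt0 y : 0 < radius y.
Proof. by rewrite /radius; case: cid2. Qed.

Lemma radiusP y z z' w w' : fibre D y z -> fibre D y z' ->
  unit_square w -> unit_square w' -> q w = q w' ->
  ball z (radius y) w -> ball z' (radius y) w' ->
  exists (j : piece D) t t', [/\ unit_square t /\ unit_square t',
      z = left_of j t, z' = right_of j t,
      w = left_of j t' & w' = right_of j t'].
Proof. by rewrite /radius; case: cid2 => e e0 /= He; exact: He. Qed.

Definition germ_rel (y y' : S) : set H := [set h | exists z w,
  [/\ fibre D y z, fibre D y' w, ball z (radius y) w & h = ((lam z)^-1 * lam w)%g]].

(** Parallel transport of the local system from [y] to a point [y'] close to
    [y]: it can be computed with any lifts of [y] and [y'] that are close to each
    other. *)
Definition germ (y y' : S) : H := xget 1%g (germ_rel y y').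

Lemma germE y y' h : germ_rel y y' h -> germ y y' = h.
Proof.
move=> yh; apply: xget_unique => // h' [z' [w' [yz' [Qw' qw'] zw' ->]]].
have [z [w [yz [Qw qw] zw ->]]] := yh.
have qww' : q w' = q w by rewrite qw qw'.
have [j [t [t' [[Qt Qt'] -> -> -> ->]]]] := radiusP yz' yz Qw' Qw qww' zw' zw.
apply: (mulgI (lam (left_of j t))); apply: (mulIg (lam (right_of j t'))^-1%g).
by rewrite mulVKg mulgA mulgK; exact/esym/lam_piece.
Qed.

Lemma germ_refl y : germ y y = 1%g.
Proof.
have [z Qz qz] := proj_surj D y.
apply: germE; exists z, z; split; rewrite ?mulVg //.
by apply: ballxx; exact: radius_gt0.
Qed.

Lemma germ_cocycle y y' : tube D y (radius y) y' ->
  \forall y'' \near y', germ y y'' = (germ y y' * germ y' y'')%g.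
Proof.
move=> tubey.
have [||eta eta0 Heta] := @common_radius R _ (fibre D y')
   (fun w eta => eta <= radius y' /\ exists2 z, fibre D y z &
       forall u, ball w eta u -> ball z (radius y) u) (finite_fibre D y').
- move=> w e e' /andP[_ lee] [le_e [z yz Hz]]; split; first exact: le_trans le_e.
  by exists z => // u /(le_ball lee)/Hz.
- move=> w y'w; have [z yz zw] := tubey w y'w.
  have /nbhs_ballP[e /= e_gt0 He] : nbhs w (ball z (radius y)).
    by apply: open_nbhs_nbhs; split => //; apply: ball_open; exact: radius_gt0.
  exists (Num.min e (radius y')); first by rewrite lt_min e_gt0 radius_gt0.
  split; first by rewrite ge_min lexx orbT.
  by exists z => // u wu; apply: He; apply: le_ball wu; rewrite ge_min lexx.
have := near_tube D y' eta0; apply: filterS => y'' tubey''.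
have [u Qu qu] := proj_surj D y''.
have [w y'w wu] := tubey'' u (conj Qu qu).
have [le_eta [z yz zu]] := Heta w y'w.
rewrite (@germE y y'' ((lam z)^-1 * lam u)%g); last by exists z, u; split => //; exact: zu.
rewrite (@germE y y' ((lam z)^-1 * lam w)%g); last first.
  by exists z, w; split => //; apply: zu; exact: ballxx.
rewrite (@germE y' y'' ((lam w)^-1 * lam u)%g); last first.
  by exists w, u; split => //; exact: le_ball wu.
by rewrite !mulgA mulgK.
Qed.

Lemma germ_proj z : unit_square z ->
  \forall w \near z, unit_square w -> germ (q z) (q w) = ((lam z)^-1 * lam w)%g.
Proof.
move=> Qz; have := nbhsx_ballx z (radius (q z)) (radius_gt0 (q z)).
by apply: filterS => w zw Qw; apply: germE; exists z, w.
Qed.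

(** [l] lifts [f] to a section of the local system over [K]. *)
Definition flat (T : topologicalType) (K : set T) (f : T -> S) (l : T -> H) :=
  forall s, K s -> \forall s' \near s, K s' -> l s' = (l s * germ (f s) (f s'))%g.

Section Flat.
Variable T : topologicalType.
Implicit Types (K : set T) (f : T -> S) (l : T -> H).

Lemma flat_sub K K' f l : K' `<=` K -> flat K f l -> flat K' f l.
Proof.
move=> sub fl s /sub/fl; apply: filterS => s' Es' /sub; exact: Es'.
Qed.

Lemma flat_ext K f f' l : (forall s, K s -> f s = f' s) -> flat K f l -> flat K f' l.
Proof.
move=> ff' fl s Ks; have := fl s Ks; apply: filterS => s' Es' Ks'.
by rewrite -!ff' //; exact: Es'.
Qed.

Lemma flat_mul K f l h : flat K f l -> flat K f (fun s => h * l s)%g.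
Proof.
move=> fl s Ks; have := fl s Ks; apply: filterS => s' Es' Ks'.
by rewrite Es' // mulgA.
Qed.

Lemma flat_comp (T' : topologicalType) (K0 : set T') (al : T' -> T) K f l :
  continuous al -> (forall s, K0 s -> K (al s)) -> flat K f l ->
  flat K0 (f \o al) (l \o al).
Proof.
move=> cal alK fl s K's; have := cal s _ (fl _ (alK s K's)).
rewrite /nbhs /=; apply: filterS => s' /= Es' K's'; exact/Es'/alK.
Qed.

(** Local existence of flat sections. *)
Lemma flat_germ K f s0 : continuous f ->
  (forall s, K s -> tube D (f s0) (radius (f s0)) (f s)) ->
  flat K f (fun s => germ (f s0) (f s)).
Proof.
move=> cf tubeK s Ks; have := cf s _ (germ_cocycle (tubeK s Ks)).
by rewrite /nbhs /=; apply: filterS.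
Qed.

Lemma flat_proj (gam : T -> R * R) K : continuous gam ->
  (forall s, K s -> unit_square (gam s)) ->
  flat K (fun s => q (gam s)) (fun s => lam (gam s)).
Proof.
move=> cgam gamQ s Ks; have := cgam s _ (germ_proj (gamQ s Ks)).
rewrite /nbhs /=; apply: filterS => s' /= Es' Ks'.
by rewrite Es' ?mulVKg //; exact: gamQ.
Qed.

Lemma flat_glue K1 K2 f l1 l2 : closed K1 -> closed K2 ->
  (forall s, K1 s -> K2 s -> l1 s = l2 s) ->
  flat K1 f l1 -> flat K2 f l2 -> exists l, flat (K1 `|` K2) f l /\
    (forall s, K1 s -> l s = l1 s) /\ (forall s, K2 s -> l s = l2 s).
Proof.
move=> cl1 cl2 l12 fl1 fl2.
pose l s := if `[< K1 s >] then l1 s else l2 s.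
have lK1 s : K1 s -> l s = l1 s by move=> K1s; rewrite /l asboolT.
have lK2 s : K2 s -> l s = l2 s.
  by move=> K2s; rewrite /l; case: asboolP => // K1s; exact: l12.
have away K s : closed K -> ~ K s -> \forall s' \near s, ~ K s'.
  by move=> clK nKs; apply: open_nbhs_nbhs; split => //; exact: closed_openC.
exists l; split; last by split.
move=> s Ks.
have n1 : \forall s' \near s, K1 s' -> l s' = (l s * germ (f s) (f s'))%g.
  have [K1s|nK1s] := pselect (K1 s); last first.
    by have := away _ _ cl1 nK1s; apply: filterS.
  have := fl1 s K1s; apply: filterS => s' Es' K1s'.
  by rewrite !lK1 // Es'.
have n2 : \forall s' \near s, K2 s' -> l s' = (l s * germ (f s) (f s'))%g.
  have [K2s|nK2s] := pselect (K2 s); last first.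
    by have := away _ _ cl2 nK2s; apply: filterS.
  have := fl2 s K2s; apply: filterS => s' Es' K2s'.
  by rewrite !lK2 // Es'.
move: n1 n2; apply: filterS2 => s' E1 E2 [] //.
Qed.

End Flat.

Definition itv (a b : R) : set R := [set s | a <= s <= b].

Lemma closed_itv a b : closed (itv a b).
Proof.
have -> : itv a b = `[a, b]%classic by apply/seteqP; split=> s; rewrite /= in_itv.
exact: interval_closed.
Qed.

Lemma itvU a b c : a <= b -> b <= c -> itv a b `|` itv b c = itv a c.
Proof.
move=> ab bc; apply/seteqP; split=> s; rewrite /itv /=; first by case; lra.
by move=> /andP[as_ sc]; have [sb|bs] := leP s b; [left|right]; lra.
Qed.

Lemma locally_constant_itv (X : Type) (phi : R -> X) a b : a <= b ->
  (forall s, itv a b s -> \forall s' \near s, itv a b s' -> phi s' = phi s) ->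
  phi a = phi b.
Proof.
move=> leab lc; pose al (s : R) : R := a + (b - a) * s.
have cal : continuous al by rewrite /al; cont.
have al_in s : 0 <= s <= 1 -> itv a b (al s).
  by move=> s01; rewrite /itv /al /=; apply/andP; split; nra.
have -> : a = al 0 by rewrite /al mulr0 addr0.
have -> : b = al 1 by rewrite /al mulr1 subrKC.
apply: (interval_induction (P := fun u v => phi (al u) = phi (al v))).
  by move=> u v w _ _ -> ->.
move=> t t01; have := cal t _ (lc _ (al_in t t01)).
move=> /nbhs_ballP[e /= e0 He]; exists e => // u v u0 v1 /andP[ut tv] tu vt.
have E s : 0 <= s <= 1 -> t - e < s < t + e -> phi (al s) = phi (al t).
  move=> s01 ste; apply: He; last exact: al_in.
  by rewrite /ball /= ltr_norml; lra.
by rewrite !E //; lra.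
Qed.

(** Transport multiplies on the right, so it cancels in the quotient of two flat
    sections, which is therefore locally constant. *)
Lemma flat_unique (f : R -> S) (l l' : R -> H) a b : a <= b ->
  flat (itv a b) f l -> flat (itv a b) f l' ->
  (l a * (l' a)^-1 = l b * (l' b)^-1)%g.
Proof.
move=> leab fl fl'; apply: (@locally_constant_itv _ (fun s => l s * (l' s)^-1)%g a b leab).
move=> s Ks; have := fl' s Ks; have := fl s Ks; apply: filterS2 => s' E E' Ks'.
by rewrite E // E' // invgM mulgA mulgK.
Qed.

(** Holonomy is a relation, since flat sections are not given by a formula. *)
Definition holonomy (p : R -> S) a b (h : H) :=
  exists2 l, flat (itv a b) p l & h = ((l a)^-1 * l b)%g.

Lemma holonomy_unique p a b h h' : a <= b ->
  holonomy p a b h -> holonomy p a b h' -> h = h'.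
Proof.
move=> leab [l fl ->] [l' fl' ->]; have := flat_unique leab fl fl'.
move=> E; apply: (mulgI (l a)); apply: (mulIg (l' b)^-1%g).
by rewrite mulVKg -E mulgA mulgK.
Qed.

Lemma holonomy_ext p p' a b h : (forall s, a <= s <= b -> p s = p' s) ->
  holonomy p a b h -> holonomy p' a b h.
Proof. by move=> pp' [l fl ->]; exists l => //; apply: flat_ext fl. Qed.

Lemma holonomy_reparam p (al : R -> R) a b h : continuous al ->
  (forall s, a <= s <= b -> al a <= al s <= al b) ->
  holonomy p (al a) (al b) h -> holonomy (fun s => p (al s)) a b h.
Proof. by move=> cal alK [l fl ->]; exists (l \o al) => //; apply: flat_comp fl. Qed.

Lemma holonomy_add p a b c h h' : a <= b -> b <= c ->
  holonomy p a b h -> holonomy p b c h' -> holonomy p a c (h * h')%g.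
Proof.
move=> ab bc [l fl ->] [l' fl' ->].
have [|l0 [fl0 [l0l l0l']]] := flat_glue (closed_itv (a := a) (b := b))
    (closed_itv (a := b) (b := c)) _ fl (flat_mul (l b * (l' b)^-1)%g fl').
  move=> s s1 s2; have -> : s = b by move: s1 s2; rewrite /itv /=; lra.
  by rewrite mulgVK.
rewrite itvU // in fl0; exists l0 => //.
rewrite l0l ?l0l' /itv /= ?lexx ?ab ?bc //.
by rewrite !mulgA.
Qed.

Lemma holonomy_proj (gam : R -> R * R) a b : continuous gam -> a <= b ->
  (forall s, a <= s <= b -> unit_square (gam s)) ->
  holonomy (fun s => q (gam s)) a b ((lam (gam a))^-1 * lam (gam b))%g.
Proof. by move=> cgam leab gamQ; exists (lam \o gam) => //; exact: flat_proj. Qed.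

Lemma holonomy_exists (p : R -> S) : continuous p -> exists h, holonomy p 0 1 h.
Proof.
move=> cp; apply: (interval_induction (P := fun a b => exists h, holonomy p a b h)).
  by move=> a b c ab bc [h hp] [h' hp']; exists (h * h')%g; exact: holonomy_add hp'.
move=> t t01; have := cp t _ (near_tube D (p t) (radius_gt0 (p t))).
move=> /nbhs_ballP[e /= e0 He]; exists e => // a b a0 b1 tab ta tb.
eexists; exists (fun s => germ (p t) (p s)) => //.
apply: flat_germ => // s sab; apply: He.
by rewrite /ball /= ltr_norml; move: sab; rewrite /itv /=; lra.
Qed.

Definition rect (a b c d : R) : set (R * R) := itv a b `*` itv c d.

Lemma closed_rect a b c d : closed (rect a b c d).
Proof.
have -> : rect a b c d = fst @^-1` itv a b `&` snd @^-1` itv c d by [].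
apply: closedI; apply: closed_comp (closed_itv (a := _) (b := _)) => z _.
  exact: cvg_fst.
exact: cvg_snd.
Qed.

Lemma rectUh a b c u v : a <= b -> b <= c ->
  rect a b u v `|` rect b c u v = rect a c u v.
Proof.
move=> ab bc; rewrite /rect -(itvU ab bc); apply/seteqP.
split=> z; first by case=> -[z1 z2]; split => //; [left|right].
by move=> [[z1|z1] z2]; [left|right].
Qed.

Lemma rectUv a b c u v : a <= b -> b <= c ->
  rect u v a b `|` rect u v b c = rect u v a c.
Proof.
move=> ab bc; rewrite /rect -(itvU ab bc); apply/seteqP.
split=> z; first by case=> -[z1 z2]; split => //; [left|right].
by move=> [z1 [z2|z2]]; [left|right].
Qed.

(** Along the connected edge where the two sets meet, the two sections differ by
    a constant left translation, which can be corrected. *)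
Lemma flat_glue_edge (f : R * R -> S) K1 K2 (l1 l2 : R * R -> H)
    (gam : R -> R * R) a b : continuous gam -> a <= b ->
  closed K1 -> closed K2 -> flat K1 f l1 -> flat K2 f l2 ->
  (forall z, K1 z -> K2 z -> exists2 s, a <= s <= b & z = gam s) ->
  (forall s, a <= s <= b -> K1 (gam s) /\ K2 (gam s)) ->
  exists l, flat (K1 `|` K2) f l.
Proof.
move=> cgam leab cl1 cl2 fl1 fl2 K12 gamK.
have f1 : flat (itv a b) (f \o gam) (l1 \o gam).
  by apply: flat_comp fl1 => // s /gamK[].
have f2 : flat (itv a b) (f \o gam) (l2 \o gam).
  by apply: flat_comp fl2 => // s /gamK[].
have [|l [fl _]] := flat_glue cl1 cl2 _ fl1
  (flat_mul (l1 (gam a) * (l2 (gam a))^-1)%g fl2); last by exists l.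
move=> z K1z K2z; have [s /andP[as_ sb] ->] := K12 z K1z K2z.
have sub : itv a s `<=` itv a b by move=> u; rewrite /itv /=; lra.
have := flat_unique as_ (flat_sub sub f1) (flat_sub sub f2).
by move=> /= ->; rewrite mulgVK.
Qed.

(** [interval_induction] is used in each coordinate: the square is glued from
    thin vertical strips, and each strip from small boxes. *)
Lemma flat_exists_rect (f : R * R -> S) : continuous f ->
  exists l, flat (rect 0 1 0 1) f l.
Proof.
move=> cf.
have glueh a b c u v : a <= b -> b <= c -> u <= v ->
    (exists l, flat (rect a b u v) f l) -> (exists l, flat (rect b c u v) f l) ->
    exists l, flat (rect a c u v) f l.
  move=> ab bc uv [l1 fl1] [l2 fl2]; rewrite -(rectUh _ _ ab bc).
  apply: (@flat_glue_edge f _ _ l1 l2 (fun s => (b, s)) u v) => //.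
  - by cont.
  - exact: closed_rect.
  - exact: closed_rect.
  - move=> [z1 z2] [/= z1b z2u] [/= bz1 _]; exists z2 => //; congr (_, _).
    by move: z1b bz1; rewrite /itv /=; lra.
  - by move=> s us; split; split; rewrite /itv //=; rewrite ?lexx ?ab ?bc.
have gluev a b c u v : a <= b -> b <= c -> u <= v ->
    (exists l, flat (rect u v a b) f l) -> (exists l, flat (rect u v b c) f l) ->
    exists l, flat (rect u v a c) f l.
  move=> ab bc uv [l1 fl1] [l2 fl2]; rewrite -(rectUv _ _ ab bc).
  apply: (@flat_glue_edge f _ _ l1 l2 (fun s => (s, b)) u v) => //.
  - by cont.
  - exact: closed_rect.
  - exact: closed_rect.
  - move=> [z1 z2] [/= z1b z2u] [/= _ bz2]; exists z1 => //; congr (_, _).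
    by move: z2u bz2; rewrite /itv /=; lra.
  - by move=> s us; split; split; rewrite /itv //=; rewrite ?lexx ?ab ?bc.
have shrink K K' : K' `<=` K -> (exists l, flat K f l) -> exists l, flat K' f l.
  by move=> sub [l fl]; exists l; exact: flat_sub fl.
apply: (interval_induction (P := fun a b => exists l, flat (rect a b 0 1) f l)).
  by move=> a b c ab bc; exact: glueh.
move=> t _.
have [e e0 He] : exists2 e, 0 < e & exists l, flat (rect (t - e) (t + e) 0 1) f l.
  apply: (interval_induction (P := fun c d => exists2 e, 0 < e &
      exists l, flat (rect (t - e) (t + e) c d) f l)).
    move=> c d c' cd dc' [e1 e10 He1] [e2 e20 He2].
    exists (Num.min e1 e2); first by rewrite lt_min e10.
    have [e1e e2e] : Num.min e1 e2 <= e1 /\ Num.min e1 e2 <= e2.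
      by rewrite !ge_min !lexx orbT.
    have e_gt0 : 0 < Num.min e1 e2 by rewrite lt_min e10.
    apply: (gluev _ d) => //; first lra.
      by apply: shrink He1 => -[z1 z2] [/=]; rewrite /rect /itv /=; split => /=; lra.
    by apply: shrink He2 => -[z1 z2] [/=]; rewrite /rect /itv /=; split => /=; lra.
  move=> u _.
  have := cf (t, u) _ (near_tube D (f (t, u)) (radius_gt0 (f (t, u)))).
  move=> /nbhs_ballP[e /= e0 He]; exists e => // c d c0 d1 cud uc du.
  exists (e / 2); first by rewrite divr_gt0.
  exists (fun z => germ (f (t, u)) (f z)); apply: flat_germ => // -[z1 z2] [].
  rewrite /itv /= => z1t z2u; apply: He; split; rewrite /ball /= ltr_norml; lra.
exists e => // a b a0 b1 tab ta bt; apply: shrink He => -[z1 z2] [] /=.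
by rewrite /rect /itv /=; split => /=; lra.
Qed.

End LocalSystem.

(** * Monodromy *)

Section Monodromy.
Local Open Scope ring_scope.
Variables (R : realType) (S : topologicalType) (x : S) (Gamma : groupType).
Variable cls : (R -> S) -> Gamma.
Hypothesis cls_homotopic : forall p q, is_loop x p -> is_loop x q ->
  (cls p = cls q <-> loop_homotopic x p q).
Hypothesis cls_concat : forall p q, is_loop x p -> is_loop x q ->
  cls (loop_concat p q) = (cls p * cls q)%g.
Hypothesis cls_surj : forall c : Gamma, exists2 p, is_loop x p & cls p = c.
Variable D : affine_gluing R S.
Local Notation q := (proj D).
Local Notation section := (section D).
Local Notation develop := (develop x cls D).
Variables (H : groupType) (lam : R * R -> H).
Hypothesis lam_piece : forall (j : piece D) t t', unit_square t -> unit_square t' ->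
  (lam (left_of j t) * (lam (right_of j t))^-1
   = lam (left_of j t') * (lam (right_of j t'))^-1)%g.

Local Notation hol := (holonomy D lam).
Let hol_add := holonomy_add (D := D) (lam := lam).

Lemma flat_cst_side (f : R * R -> S) l (gam : R -> R * R) y :
  continuous gam -> (forall s, itv 0 1 s -> rect 0 1 0 1 (gam s)) ->
  (forall s, itv 0 1 s -> f (gam s) = y) ->
  flat D lam (rect 0 1 0 1) f l -> l (gam 0) = l (gam 1).
Proof.
move=> cgam gamK fy fl.
have fl' := flat_ext fy (flat_comp cgam gamK fl).
apply: (@locally_constant_itv _ _ (fun s => l (gam s)) 0 1 ler01) => s Ks.
have := fl' s Ks; apply: filterS => s' /= Es' Ks'.
by rewrite Es' // germ_refl ?mulg1.
Qed.

(** The homotopy carries a flat section, which is constant along the two sides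
    that are mapped to the base point. *)
Lemma holonomy_homotopic (p p' : R -> S) h h' : loop_homotopic x p p' ->
  hol p 0 1 h -> hol p' 0 1 h' -> h = h'.
Proof.
move=> [F [cF Fp Fx]] hp hp'.
pose f (z : R * R) := F (clamp z.1, clamp z.2).
have cf : continuous f.
  apply: (continuous_retract cF (r := fun z : R * R => (clamp z.1, clamp z.2))).
    by cont.
  by move=> z; split; rewrite /= in_itv /= clamp_in.
have [l fl] := flat_exists_rect lam_piece cf.
have K0 : itv (R := R) 0 1 0 by rewrite /itv /= lexx ler01.
have K1 : itv (R := R) 0 1 1 by rewrite /itv /= lexx ler01.
have side t : itv 0 1 t -> hol (fun s => F (s, t)) 0 1 ((l (0, t))^-1 * l (1%R, t))%g.
  move=> Kt; exists (l \o (fun s => (s, t))) => //.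
  apply: (flat_ext (f := f \o (fun s => (s, t)))).
    by move=> s Ks; rewrite /f /= !clamp_id.
  by apply: flat_comp fl => [|s Ks]; [cont|split].
have Ep : h = ((l (0, 0))^-1 * l (1%R, 0%R))%g.
  apply: (holonomy_unique ler01 hp); apply: holonomy_ext (side 0 K0).
  by move=> s s01; have [] := Fp s s01.
have Ep' : h' = ((l (0, 1%R))^-1 * l (1%R, 1%R))%g.
  apply: (holonomy_unique ler01 hp'); apply: holonomy_ext (side 1 K1).
  by move=> s s01; have [] := Fp s s01.
rewrite Ep Ep'; congr (_^-1 * _)%g.
  apply: (flat_cst_side (gam := fun t => (0, t)) (y := x)) fl => //; first by cont.
  by move=> t Kt; rewrite /f /= !clamp_id ?lexx ?ler01 //; have [] := Fx t Kt.
apply: (flat_cst_side (gam := fun t => (1, t)) (y := x)) fl => //; first by cont.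
by move=> t Kt; rewrite /f /= !clamp_id ?lexx ?ler01 //; have [] := Fx t Kt.
Qed.

Lemma cts_representative (c : Gamma) : exists p : R -> S,
  [/\ continuous p, p 0 = x, p 1 = x & cls p = c].
Proof.
have [p0 lp0 <-] := cls_surj c; have [cp0 p00 p01] := lp0.
have cp : continuous (fun s => p0 (clamp s)).
  apply: (continuous_retract cp0 (cont_clamp (f := id) _)); first by cont.
  by move=> u; rewrite /= in_itv /= clamp_in.
have p0' : p0 (clamp 0) = x by rewrite clamp_le0.
have p1' : p0 (clamp 1) = x by rewrite clamp_ge1.
exists (fun s => p0 (clamp s)); split => //.
apply: (cls_ext cls_homotopic) => //; first exact: continuous_is_loop.
by move=> s s01; rewrite clamp_id.
Qed.

Definition monodromy (c : Gamma) : H :=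
  xget 1%g [set h | exists p : R -> S, [/\ continuous p, p 0 = x, p 1 = x, cls p = c
                                & hol p 0 1 h]].

Lemma monodromyE (p : R -> S) h : continuous p -> p 0 = x -> p 1 = x -> hol p 0 1 h ->
  monodromy (cls p) = h.
Proof.
move=> cp p0 p1 hp; apply: xget_unique; first by exists p.
move=> h' [p' [cp' p'0 p'1 pp' hp']].
have lp : is_loop x p by exact: continuous_is_loop.
have lp' : is_loop x p' by exact: continuous_is_loop.
exact: holonomy_homotopic ((cls_homotopic lp' lp).1 pp') hp' hp.
Qed.

Lemma monodromyM : {morph monodromy : a b / a * b}%g.
Proof.
move=> c c'; have [p [cp p0 p1 <-]] := cts_representative c.
have [p' [cp' p'0 p'1 <-]] := cts_representative c'.
have [h hp] := holonomy_exists lam_piece cp.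
have [h' hp'] := holonomy_exists lam_piece cp'.
rewrite (monodromyE cp p0 p1 hp) (monodromyE cp' p'0 p'1 hp').
rewrite -cls_concat; try exact: continuous_is_loop.
have h2 : (2 : R) * 2^-1 = 1 by rewrite mulfV.
have h21 : (2 : R) * 1 - 1 = 1 by lra.
have cpp : continuous (loop_concat p p').
  rewrite /loop_concat; under eq_fun do rewrite -subr_le0.
  apply: cont_paste; [by cont|by cont|by cont|move=> s s2].
  by rewrite (_ : s = 2^-1) ?h2 ?subrr ?p1 //; lra.
apply: monodromyE => //.
- by rewrite /loop_concat ifT ?mulr0 //; lra.
- by rewrite /loop_concat ifF ?h21 //; apply/negbTE; lra.
apply: (hol_add (b := 2^-1)); [lra|lra| |].
  apply: (holonomy_ext (p := fun s => p (2 * s))).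
    by move=> s s2; rewrite /loop_concat ifT //; lra.
  apply: (holonomy_reparam (al := fun s => 2 * s)); [by cont|by move=> s s2; lra|].
  by rewrite mulr0 h2.
apply: (holonomy_ext (p := fun s => p' (2 * s - 1))).
  move=> s s2; rewrite /loop_concat; case: ifP => // s2'.
  have -> : s = 2^-1 by lra.
  by rewrite h2 subrr p1 p'0.
apply: (holonomy_reparam (al := fun s => 2 * s - 1)); [by cont|by move=> s s2; lra|].
by rewrite h2 h21 subrr.
Qed.

(** The closed path of a straight path consists of three images of segments of
    the square, and [lam] itself is flat along each of them. *)
Lemma monodromy_develop z : unit_square z ->
  monodromy (develop z) = ((lam (section x))^-1
    * (lam z * (lam (section (q z)))^-1) * lam (section x))%g.
Proof.
move=> Qz; set z0 := section x.
have [Qz0 qz0] := sectionP D x; have [Qzq qzq] := sectionP D (q z).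
pose p s := q (seg z0 z s); pose W := closed_path (tail x D) p 0 1.
have p0 : p 0 = x by rewrite /p seg0.
have p1 : p 1 = q z by rewrite /p seg1.
have cp : continuous p by rewrite /p; cont.
have cW : continuous W.
  by apply: cont_closed_path => //; [exact: cont_tail|exact: tail_start].
have Wl : W (0 - 1) = x by apply: closed_path_l; exact: tail_end.
have Wr : W (1 + 1) = x by apply: closed_path_r => //; exact: tail_end.
have aff0 : 0 - 1 + (1 + 1 - (0 - 1)) * 0 = 0 - 1 :> R by lra.
have aff1 : 0 - 1 + (1 + 1 - (0 - 1)) * 1 = 1 + 1 :> R by lra.
rewrite /develop /path_cls -/z0 -/p -/W /seg_cls.
apply: monodromyE; rewrite ?aff0 ?aff1 //; first by cont.
apply: (holonomy_reparam (al := fun s => 0 - 1 + (1 + 1 - (0 - 1)) * s));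
  [by cont|by move=> s s01; lra|rewrite aff0 aff1].
have <- : ((lam z0)^-1 * lam z0 * ((lam z0)^-1 * lam z
            * ((lam (section (q z)))^-1 * lam z0))
         = (lam z0)^-1 * (lam z * (lam (section (q z)))^-1) * lam z0)%g.
  by rewrite mulVg mul1g !mulgA.
apply: (hol_add (b := 0)); [lra|lra| |].
  apply: (holonomy_ext (p := fun s => q ((fun=> z0) s))).
    by move=> s s0; rewrite /W /closed_path ifT ?p0 /tail ?segxx //; lra.
  by apply: (holonomy_proj lam_piece (gam := fun=> z0)) => //; cont.
apply: (hol_add (b := 1)); [lra|lra| |].
  apply: (holonomy_ext (p := p)).
    move=> s s01; rewrite /W /closed_path; case: ifP => s0.
      have -> : s = 0 by lra.
      by rewrite p0 tail_start // subrr.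
    by rewrite ifT //; lra.
  have cs : continuous (fun s => seg z0 z s) by cont.
  have := holonomy_proj lam_piece cs ler01.
  rewrite seg0 seg1; apply.
  by move=> s s01; exact: unit_square_seg.
have E0 : clamp (1 - 1) = 0 :> R by rewrite clamp_le0 // subrr.
have E1 : clamp (1 + 1 - 1) = 1 :> R by rewrite clamp_ge1 //; lra.
apply: (holonomy_ext (p := fun s => q (seg (section (q z)) z0 (clamp (s - 1))))).
  move=> s s1; rewrite /W /closed_path p1 ifF; last by apply/negbTE; lra.
  case: ifP => // s1'; have -> : s = 1 by lra.
  by rewrite E0 seg0 p1.
have cs : continuous (fun s : R => seg (section (q z)) z0 (clamp (s - 1))) by cont.
have := @holonomy_proj _ _ _ _ _ lam_piece _ 1 (1 + 1) cs.
rewrite E0 E1 seg0 seg1; apply; first by lra.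
by move=> s s01; apply: unit_square_seg => //; exact: clamp_in.
Qed.

(** In the monodromy of a transition the terms that depend on the chosen lift
    cancel; conjugation by the label of the base point removes the rest. *)
Theorem transitions_extend : exists f : group_hom Gamma H, forall w w',
  unit_square w -> unit_square w' -> q w = q w' ->
  f (develop w * (develop w')^-1)%g = (lam w * (lam w')^-1)%g.
Proof.
set a := lam (section x).
have fM : {morph (fun c => a * monodromy c * a^-1) : c c' / c * c'}%g.
  by move=> c c' /=; rewrite monodromyM !mulgA mulgVK.
have fE z : unit_square z ->
    hom_of fM (develop z) = (lam z * (lam (section (q z)))^-1)%g.
  by move=> Qz /=; rewrite monodromy_develop // -(mulgA a^-1%g) mulVKg mulgK.
exists (hom_of fM) => w w' Qw Qw' qww'.
by rewrite gmulfM gmulfV !fE // qww' invgM invgK mulgA mulgVK.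
Qed.

End Monodromy.

(** * Elliptic coordinates on the disk *)

Section EllipticCoordinates.
Local Open Scope ring_scope.
Variable R : realType.
Implicit Types (u v r : R) (z w : R * R).

(** Angles are measured in turns. *)
Definition tcos u := cos (2 * pi * u).
Definition tsin u := sin (2 * pi * u).
Definition turn u : R * R := (tcos u, tsin u).

Lemma turn_norm u : tcos u ^+ 2 + tsin u ^+ 2 = 1.
Proof. exact: cos2Dsin2. Qed.

Lemma turn_inj u v : 0 <= u <= 1 -> 0 <= v <= 1 -> turn u = turn v ->
  [\/ u = v, u = 0 /\ v = 1 | u = 1 /\ v = 0].
Proof.
move=> u01 v01 [ecos esin]; set e := pi * (u - v).
have sin_e : sin e = 0.
  have : cos (2 * pi * u - 2 * pi * v) = 1.
    rewrite cosB -/(tcos u) -/(tcos v) -/(tsin u) -/(tsin v) -ecos -esin -!expr2.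
    exact: cos2Dsin2.
  rewrite (_ : _ - _ = e *+ 2); last by rewrite /e mulr2n; lra.
  rewrite cos_mulr2n cos2sin2 => e1.
  by apply/eqP; rewrite -sqrf_eq0; apply/eqP; lra.
have pi0 := pi_gt0 R.
have [ltuv|ltvu|] := ltgtP u v; last by constructor 1.
  constructor 2; have [v_u|v_u] := ltP (v - u) 1; last by lra.
  have : 0 < sin (- e).
    apply: sin_gt0_pi; rewrite /e -mulrN opprB mulr_gt0 ?subr_gt0 //=.
    by rewrite -[ltRHS]mulr1 ltr_pM2l.
  by rewrite sinN sin_e oppr0 ltxx.
constructor 3; have [u_v|u_v] := ltP (u - v) 1; last by lra.
have : 0 < sin e.
  apply: sin_gt0_pi; rewrite /e mulr_gt0 ?subr_gt0 //=.
  by rewrite -[ltRHS]mulr1 ltr_pM2l.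
by rewrite sin_e ltxx.
Qed.

Lemma tcosC u : tcos (1 - u) = tcos u.
Proof.
rewrite /tcos (_ : 2 * pi * (1 - u) = - (2 * pi * u) + pi *+ 2).
  by rewrite cosD2pi cosN.
by rewrite mulr2n; lra.
Qed.

Lemma tsinC u : tsin (1 - u) = - tsin u.
Proof.
rewrite /tsin (_ : 2 * pi * (1 - u) = - (2 * pi * u) + pi *+ 2).
  by rewrite sinD2pi sinN.
by rewrite mulr2n; lra.
Qed.

Lemma tcos01 : tcos 0 = tcos 1.
Proof.
by rewrite /tcos mulr0 mulr1 cos0 (_ : 2 * pi = pi *+ 2) ?cos2pi // mulr2n; lra.
Qed.

Lemma tsin01 : tsin 0 = tsin 1.
Proof.
by rewrite /tsin mulr0 mulr1 sin0 (_ : 2 * pi = pi *+ 2) ?sin2pi // mulr2n; lra.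
Qed.

Lemma turn_surj x y : x ^+ 2 + y ^+ 2 = 1 -> exists2 u, 0 <= u <= 1 & turn u = (x, y).
Proof.
move=> xy1; have x1 : -1 <= x <= 1 by have y2 := sqr_ge0 y; apply/andP; split; nra.
have pi0 := pi_gt0 R.
have a0 := acos_ge0 x1; have api := acos_lepi x1.
have cosa : cos (acos x) = x by apply: acosK; rewrite in_itv.
have sina : sin (acos x) = `|y|.
  rewrite sin_acos // (_ : 1 - x ^+ 2 = y ^+ 2) ?sqrtr_sqr //; lra.
pose u := acos x / (2 * pi).
have uE : 2 * pi * u = acos x by rewrite /u mulrCA mulfV ?mulr1 // gt_eqF //; lra.
have u01 : 0 <= u <= 1.
  rewrite /u divr_ge0 //=; last by lra.
  by rewrite ler_pdivrMr ?mul1r; lra.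
have [y0|y0] := leP 0 y.
  by exists u => //; rewrite /turn /tcos /tsin uE cosa sina ger0_norm.
exists (1 - u); first by lra.
by rewrite /turn tcosC tsinC /tcos /tsin uE cosa sina ltr0_norm //= opprK.
Qed.

(** Elliptic coordinates on the unit disk.  Unlike polar ones they have finite
    fibres: the segment [r = 0] is folded in two instead of being collapsed. *)
Definition ellipse z : R * R := ((1 + z.1) / 2 * tcos z.2, z.1 * tsin z.2).

Lemma cont_ellipse : continuous ellipse.
Proof.
have ccos : continuous (@cos R) by exact: continuous_cos.
have csin : continuous (@sin R) by exact: continuous_sin.
by rewrite /ellipse /tcos /tsin /=; cont.
Qed.

Lemma ellipse1 u : ellipse (1, u) = turn u.
Proof. by rewrite /ellipse /turn /= mulfV ?mul1r. Qed.

Lemma ellipse_seam r : ellipse (r, 0) = ellipse (r, 1).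
Proof. by rewrite /ellipse /= tcos01 tsin01. Qed.

Lemma ellipse_fold u : ellipse (0, u) = ellipse (0, 1 - u).
Proof. by rewrite /ellipse /= tcosC !mul0r. Qed.

Lemma ellipse_disk z : unit_square z -> unit_disk (ellipse z).
Proof.
case: z => r u [/= r01 u01]; rewrite /unit_disk /ellipse /= !exprMn.
have := turn_norm u; set A := tcos u ^+ 2; set B := tsin u ^+ 2 => AB.
have A0 : 0 <= A by exact: sqr_ge0.
have B0 : 0 <= B by exact: sqr_ge0.
have r1 : ((1 + r) / 2) ^+ 2 <= 1 by rewrite expr_le1 //; lra.
have r2 : r ^+ 2 <= 1 by rewrite expr_le1 //; lra.
by nra.
Qed.

(** Ellipses with different [r] are disjoint, the larger one having both
    semi-axes larger. *)
Lemma ellipse_radius r r' A A' : 0 <= r -> r < r' -> 0 <= A <= 1 -> 0 <= A' <= 1 ->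
  (1 + r) ^+ 2 * A = (1 + r') ^+ 2 * A' -> r ^+ 2 * (1 - A) = r' ^+ 2 * (1 - A') ->
  False.
Proof.
move=> r0 rr' A01 A'01 e1 e2.
have h1 : (1 + r) ^+ 2 < (1 + r') ^+ 2 by nra.
have h2 : r ^+ 2 < r' ^+ 2 by nra.
have [AA'|A'A] := ltP A A'; first by nra.
have : r' ^+ 2 * (1 - A') <= r' ^+ 2 * (1 - A).
  by rewrite -e2; apply: ler_wpM2r; lra.
have r'2 : 0 < r' ^+ 2 by apply: exprn_gt0; lra.
rewrite ler_pM2l // => A_A'.
have eA : A = A' by lra.
have A0 : A = 0.
  apply: contrapT => /eqP A0; have Agt : 0 < A by rewrite lt_def A0; lra.
  by move: e1; rewrite -eA; nra.
by move: e2; rewrite -eA A0; lra.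
Qed.

Lemma ellipse_inj z w : unit_square z -> unit_square w -> ellipse z = ellipse w ->
  [\/ z = w,
      exists b : bool, z = (z.1, b%:R) /\ w = (z.1, (~~ b)%:R)
    | z = (0, z.2) /\ w = (0, 1 - z.2)].
Proof.
case: z w => [r u] [r' v] [/= r01 u01] [/= r'01 v01]; rewrite /ellipse /= => -[ex ey].
have tu := turn_norm u; have tv := turn_norm v.
have sx : (1 + r) ^+ 2 * tcos u ^+ 2 = (1 + r') ^+ 2 * tcos v ^+ 2.
  rewrite -!exprMn; congr (_ ^+ 2); lra.
have sy : r ^+ 2 * (1 - tcos u ^+ 2) = r' ^+ 2 * (1 - tcos v ^+ 2).
  rewrite (_ : 1 - tcos u ^+ 2 = tsin u ^+ 2); last by lra.
  rewrite (_ : 1 - tcos v ^+ 2 = tsin v ^+ 2); last by lra.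
  by rewrite -!exprMn ey.
have bnd t : 0 <= tcos t ^+ 2 <= 1.
  by have := turn_norm t; have := sqr_ge0 (tcos t); have := sqr_ge0 (tsin t); lra.
have [rr'|r'r|eqr] := ltgtP r r'.
- by have := ellipse_radius _ rr' (bnd u) (bnd v) sx sy; case; lra.
- by have := ellipse_radius _ r'r (bnd v) (bnd u) (esym sx) (esym sy); case; lra.
rewrite -eqr in ex ey *.
have r1 : (1 + r) / 2 != 0 by rewrite gt_eqF //; lra.
have {}ex : tcos u = tcos v := mulfI r1 ex.
have same : turn u = turn v -> [\/ (r, u) = (r, v),
    exists b : bool, (r, u) = (r, b%:R) /\ (r, v) = (r, (~~ b)%:R)
  | (r, u) = (0, u) /\ (r, v) = (0, 1 - u)].
  move=> /(turn_inj u01 v01)[->|[-> ->]|[-> ->]]; first by constructor 1.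
    by constructor 2; exists false.
  by constructor 2; exists true.
have [r0|r0] := eqVneq r 0; last first.
  by apply: same; rewrite /turn ex (mulfI r0 ey).
have [eqy|neqy] := eqVneq (tsin u) (tsin v).
  by apply: same; rewrite /turn ex eqy.
have oppy : tsin u = - tsin v.
  move: neqy; rewrite -subr_eq0 => neqy.
  apply/eqP; rewrite -addr_eq0; apply/eqP/(mulfI neqy); rewrite mulr0.
  by move: tu tv => /=; rewrite ex; lra.
have /(turn_inj u01 _)[] : turn u = turn (1 - v).
- by rewrite /turn tcosC tsinC -ex -oppy.
- by lra.
- by move=> ->; constructor 3; rewrite r0 opprB subrKC.
- move=> [-> v1]; have -> : v = 0 by lra.
  by constructor 1.
move=> [-> v1]; have -> : v = 1 by lra.
by constructor 1.
Qed.

(** Off the axis [y = 0], the parameter of the ellipse through [(x, y)] is a root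
    of [f], found by the intermediate value theorem. *)
Lemma ellipse_surj d : unit_disk d -> exists2 z, unit_square z & ellipse z = d.
Proof.
case: d => x y; rewrite /unit_disk /= => xy1.
have fin r X Y : 0 <= r <= 1 -> X ^+ 2 + Y ^+ 2 = 1 -> x = (1 + r) / 2 * X ->
    y = r * Y -> exists2 z, unit_square z & ellipse z = (x, y).
  move=> r01 /turn_surj[u u01 uE] xE yE; exists (r, u) => //.
  by case: uE => Xu Yu; rewrite /ellipse /= Xu Yu xE yE.
have [y0|y0] := eqVneq y 0.
  have [x2|x2] := leP `|x| 2^-1.
    have x4 : x ^+ 2 <= 4^-1.
      by rewrite -real_normK ?num_real // (_ : 4^-1 = 2^-1 ^+ 2) ?ler_sqr ?nnegrE //; lra.
    apply: (fin 0 (2 * x) (Num.sqrt (1 - (2 * x) ^+ 2))); [lra| |lra|by rewrite mul0r].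
    by rewrite sqr_sqrtr; lra.
  have x0 : x != 0 by rewrite -normr_gt0; lra.
  have x_1 : `|x| <= 1.
    by rewrite -ler_sqr ?nnegrE // real_normK ?num_real //; move: xy1; rewrite y0; lra.
  apply: (fin (2 * `|x| - 1) (x / `|x|) 0); [lra| | |by rewrite mulr0].
    rewrite expr0n addr0 exprMn exprVn real_normK ?num_real //.
    by rewrite mulfV // expf_neq0.
  rewrite (_ : (1 + (2 * `|x| - 1)) / 2 = `|x|); last by lra.
  by rewrite mulrCA mulfV ?mulr1 // normr_eq0.
pose f (r : R) : R := 4 * (x * r * (x * r)) + y * (1 + r) * (y * (1 + r))
  - r * (1 + r) * (r * (1 + r)).
have cf : continuous f by rewrite /f; cont.
have f0 : 0 < f 0.
  rewrite (_ : f 0 = y ^+ 2); last by rewrite /f; lra.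
  by rewrite exprn_even_gt0.
have f1 : f 1 <= 0 by rewrite /f; lra.
have [|r] := @IVT R f 0 1 0 ler01 (continuous_subspaceT cf).
  by rewrite ge_min le_max f1 (ltW f0) orbT.
rewrite in_itv /= => r01 fr.
have r0 : r != 0 by apply/eqP => r0; move: fr f0; rewrite r0 => ->; rewrite ltxx.
have r10 : 1 + r != 0 by rewrite gt_eqF //; lra.
apply: (fin r (2 * x / (1 + r)) (y / r)) => //; last 2 first.
- rewrite (mulrC (2 * x)) mulrACA mulfV // mul1r; lra.
- by rewrite mulrCA mulfV ?mulr1.
have rr0 : (r * (1 + r)) ^+ 2 != 0 by rewrite sqrf_eq0 mulf_neq0.
apply: (mulfI rr0); rewrite mulr1 mulrDr -!exprMn.
have -> : r * (1 + r) * (2 * x / (1 + r)) = 2 * (x * r).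
  transitivity (2 * (x * r) * ((1 + r) / (1 + r))); first lra.
  by rewrite mulfV // mulr1.
have -> : r * (1 + r) * (y / r) = y * (1 + r).
  transitivity (y * (1 + r) * (r / r)); first lra.
  by rewrite mulfV // mulr1.
by move: fr; rewrite /f; lra.
Qed.

End EllipticCoordinates.

(** * The identifications on the boundary of the polygon *)

Section PolygonRelation.
Local Open Scope ring_scope.
Variables (R : realType) (g : nat).
Hypothesis g_gt0 : (0 < g)%N.
Local Notation N := ((4 * g)%:R : R).
Local Notation side := (@polygon_side R g).

(** In each block of four sides [a b a^-1 b^-1], the side to be glued lies two
    sides ahead or two sides back. *)
Definition partner (k : nat) : nat := if (k %% 4 < 2)%N then k.+2 else k.-2.

Lemma partner_lt k : (k < 4 * g)%N -> (partner k < 4 * g)%N.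
Proof. by clear g_gt0; rewrite /partner; case: ifP; lia. Qed.

Lemma partnerK k : partner (partner k) = k.
Proof. by clear g_gt0; rewrite /partner; case: (ifP (k %% 4 < 2)%N); case: ifP; lia. Qed.

Lemma N_gt0 : 0 < N. Proof. by rewrite ltr0n; lia. Qed.

(** Angle, in turns, of the point with parameter [s] on side [k]. *)
Definition pos (k : nat) (s : R) : R := (k%:R + s) / N.

Lemma polygon_sideE k s : side k s = turn (pos k s).
Proof. by []. Qed.

Lemma pos_succ k : pos k 1 = pos k.+1 0.
Proof. by rewrite /pos addr0 -natr1. Qed.

Lemma side_succ k : side k 1 = side k.+1 0.
Proof. by rewrite !polygon_sideE pos_succ. Qed.

Lemma pos_ge0 k s : 0 <= s -> 0 <= pos k s.
Proof. by move=> s0; rewrite divr_ge0 ?addr_ge0 // ler0n. Qed.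

Lemma pos_in k s : (k < 4 * g)%N -> 0 <= s <= 1 -> 0 <= pos k s <= 1.
Proof.
move=> kg /andP[s0 s1]; rewrite pos_ge0 //= ler_pdivrMr ?N_gt0 // mul1r.
by apply: (@le_trans _ _ k.+1%:R); rewrite ?ler_nat // -natr1 lerD2l.
Qed.

Lemma pos_vertex_in m : (m <= 4 * g)%N -> 0 <= pos m 0 <= 1.
Proof.
move=> mg; rewrite pos_ge0 //= ler_pdivrMr ?N_gt0 // mul1r addr0.
by rewrite ler_nat.
Qed.

Lemma pos_inj k s j s' : 0 <= s <= 1 -> 0 <= s' <= 1 -> pos k s = pos j s' ->
  (k = j /\ s = s') \/ (s = 0 \/ s = 1) /\ (s' = 0 \/ s' = 1).
Proof.
move=> s01 s'01 /(mulIf _) E.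
have {}E : k%:R + s = j%:R + s' by apply: E; rewrite invr_eq0 gt_eqF // N_gt0.
have [ltkj|ltjk|eqkj] := ltngtP k j.
- have : k.+1%:R <= j%:R :> R by rewrite ler_nat.
  by rewrite -natr1 => kj; right; split; [right|left]; lra.
- have : j.+1%:R <= k%:R :> R by rewrite ler_nat.
  by rewrite -natr1 => jk; right; split; [left|right]; lra.
by left; split => //; move: E; rewrite eqkj => /addrI.
Qed.

Lemma pos_eq0 k s : 0 <= s <= 1 -> pos k s = 0 -> s = 0.
Proof.
move=> s01 /eqP; rewrite mulf_eq0 invr_eq0 (gt_eqF N_gt0) orbF => /eqP.
by have := ler0n R k; lra.
Qed.

Lemma pos_eq1 k s : (k < 4 * g)%N -> 0 <= s <= 1 -> pos k s = 1 -> s = 1.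
Proof.
move=> kg s01 /(congr1 ( *%R^~ N)); rewrite mul1r mulfVK ?gt_eqF ?N_gt0 //.
have : k.+1%:R <= N by rewrite ler_nat.
by rewrite -natr1; lra.
Qed.

Lemma side_inj k s j s' : (k < 4 * g)%N -> (j < 4 * g)%N ->
  0 <= s <= 1 -> 0 <= s' <= 1 -> side k s = side j s' ->
  (k = j /\ s = s') \/ (s = 0 \/ s = 1) /\ (s' = 0 \/ s' = 1).
Proof.
move=> kg jg s01 s'01; rewrite !polygon_sideE.
case/(turn_inj (pos_in kg s01) (pos_in jg s'01)); first exact: pos_inj.
- by move=> [/(pos_eq0 s01) -> /(pos_eq1 jg s'01) ->]; right; split; [left|right].
- by move=> [/(pos_eq1 kg s01) -> /(pos_eq0 s'01) ->]; right; split; [right|left].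
Qed.

Definition vertex (a : R * R) : Prop := exists2 m, (m <= 4 * g)%N & a = side m 0.

Lemma vertex_end k s : (k < 4 * g)%N -> s = 0 \/ s = 1 -> vertex (side k s).
Proof.
by move=> kg [->|->]; [exists k => //; lia|exists k.+1 => //; exact: side_succ].
Qed.

Lemma vertex_side k s : (k < 4 * g)%N -> 0 <= s <= 1 -> vertex (side k s) ->
  s = 0 \/ s = 1.
Proof.
move=> kg s01 [m mg E].
have [mlt|mge] := ltnP m (4 * g).
  have [|[_ ->]|[]//] := side_inj kg mlt s01 _ E; first by lra.
  by left.
have m4g : m = (4 * g).-1.+1 by lia.
have [|||[_ ->]|[]//] := @side_inj k s (4 * g).-1 1 kg _ s01 _ _.
- by lia.
- by lra.
- by rewrite E side_succ m4g.
- by right.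
Qed.

(** The equivalence relation generated by the pairing of sides, in closed form:
    the chains of the generated relation become trivial except at corners. *)
Definition glued (a b : R * R) : Prop :=
  [\/ a = b,
      exists k s, [/\ (k < 4 * g)%N, 0 <= s <= 1, a = side k s
                    & b = side (partner k) (1 - s)]
    | vertex a /\ vertex b].

Lemma glued_sym a b : glued a b -> glued b a.
Proof.
case=> [->|[k [s [kg s01 -> ->]]]|[va vb]]; [by constructor 1| |by constructor 3].
constructor 2; exists (partner k), (1 - s); split; rewrite ?partner_lt //.
  by lra.
by rewrite partnerK; congr side; lra.
Qed.

Lemma glued_vertex a b : glued a b -> vertex a -> vertex b.
Proof.
case=> [->//|[k [s [kg s01 -> ->]]]|[]//] /(vertex_side kg s01) s_end.
by apply: vertex_end; [exact: partner_lt|case: s_end => ->; lra].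
Qed.

Lemma glued_trans a b c : glued a b -> glued b c -> glued a c.
Proof.
move=> ab bc; have [vb|nvb] := pselect (vertex b).
  by constructor 3; split; [exact: glued_vertex (glued_sym ab) vb|exact: glued_vertex bc vb].
case: ab => [->//|[k [s [kg s01 aE bE]]]|[]//].
case: bc => [<-|[j [s' [jg s'01 bE' cE]]]|[]//].
  by constructor 2; exists k, s.
have s1 : 0 <= 1 - s <= 1 by lra.
have := side_inj (partner_lt kg) jg s1 s'01; rewrite -bE -bE' => /(_ erefl).
case=> [[jE s'E]|[s_end _]]; last first.
  by case: nvb; rewrite bE; apply: vertex_end => //; exact: partner_lt.
constructor 1; rewrite aE cE -jE -s'E partnerK; congr side; lra.
Qed.

Local Notation clos := (clos_refl_sym_trans (R * R) (side_pairing g)).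

Lemma clos_glued a b : clos a b -> glued a b.
Proof.
elim=> {a b} [a b [i [s [ig s01 [[-> ->]|[-> ->]]]]]|a|a b _|a b c _ ab _].
- constructor 2; exists (4 * i)%N, s; split => //; first by lia.
  by rewrite /partner ifT; [congr side; lia|lia].
- constructor 2; exists (4 * i + 1)%N, s; split => //; first by lia.
  by rewrite /partner ifT; [congr side; lia|lia].
- by constructor 1.
- exact: glued_sym.
- exact: glued_trans ab.
Qed.

Lemma clos_side k s : (k < 4 * g)%N -> 0 <= s <= 1 ->
  clos (side k s) (side (partner k) (1 - s)).
Proof.
have step i c s0 : (c < 2)%N -> (i < g)%N -> 0 <= s0 <= 1 ->
    clos (side (4 * i + c) s0) (side (4 * i + c + 2) (1 - s0)).
  move=> c2 ig s01; apply: rst_step; exists i, s0; split => //.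
  by case: c c2 => [|[|]] // _; [left; rewrite addn0|right; rewrite -addnA].
move=> kg s01; rewrite /partner; case: ifP => k2.
  have := step (k %/ 4)%N (k %% 4)%N s k2 _ s01.
  have -> : (4 * (k %/ 4) + k %% 4)%N = k by lia.
  by rewrite addn2; apply; lia.
apply: rst_sym; have s1 : 0 <= 1 - s <= 1 by lra.
have := step (k %/ 4)%N (k %% 4 - 2)%N (1 - s) _ _ s1.
have -> : (4 * (k %/ 4) + (k %% 4 - 2))%N = k.-2 by lia.
have -> : (k.-2 + 2)%N = k by lia.
have -> : 1 - (1 - s) = s by lra.
by apply; lia.
Qed.

(** All corners of the polygon are identified: going around the glued vertex
    they come in the order [4i, 4i+3, 4i+2, 4i+1, 4i+4]. *)
Lemma clos_vertex m : (m <= 4 * g)%N -> clos (side 0 0) (side m 0).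
Proof.
have I0 : 0 <= (0 : R) <= 1 by lra.
have I1 : 0 <= (1 : R) <= 1 by lra.
have jump0 k : (k < 4 * g)%N -> clos (side k 0) (side (partner k).+1 0).
  by move=> kg; have := clos_side kg I0; rewrite subr0 side_succ.
have jump1 k : (k < 4 * g)%N -> clos (side k.+1 0) (side (partner k) 0).
  by move=> kg; have := clos_side kg I1; rewrite subrr side_succ.
have around i : (i < g)%N -> [/\ clos (side (4 * i) 0) (side (4 * i + 3) 0),
    clos (side (4 * i + 3) 0) (side (4 * i + 2) 0),
    clos (side (4 * i + 2) 0) (side (4 * i + 1) 0)
  & clos (side (4 * i + 1) 0) (side (4 * i + 4) 0)].
  move=> ig; split.
  - have := jump0 (4 * i)%N; rewrite /partner ifT; last by lia.
    by rewrite (_ : (4 * i).+3 = 4 * i + 3)%N; [apply|]; lia.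
  - have := jump1 (4 * i + 1)%N; rewrite /partner ifT; last by lia.
    rewrite (_ : (4 * i + 1).+2 = 4 * i + 3)%N; last by lia.
    rewrite (_ : (4 * i + 1).+1 = 4 * i + 2)%N; last by lia.
    by move=> j; apply: rst_sym; apply: j; lia.
  - have := jump1 (4 * i)%N; rewrite /partner ifT; last by lia.
    rewrite (_ : (4 * i).+2 = 4 * i + 2)%N; last by lia.
    rewrite (_ : (4 * i).+1 = 4 * i + 1)%N; last by lia.
    by move=> j; apply: rst_sym; apply: j; lia.
  - have := jump0 (4 * i + 1)%N; rewrite /partner ifT; last by lia.
    by rewrite (_ : (4 * i + 1).+3 = 4 * i + 4)%N; [apply|]; lia.
have corner i : (i <= g)%N -> clos (side 0 0) (side (4 * i) 0).
  elim: i => [|i IHi] ig; first by rewrite muln0; exact: rst_refl.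
  have [c1 c2 c3 c4] := around i ig.
  apply: rst_trans (IHi (ltnW ig)) _; apply: rst_trans c1 _.
  apply: rst_trans c2 _; apply: rst_trans c3 _.
  by rewrite (_ : 4 * i.+1 = 4 * i + 4)%N; [exact: c4|lia].
move=> mg; have [m4|m4] := leqP (4 * g) m.
  by have -> : m = (4 * g)%N; [lia|exact: corner].
have i4 : (m %/ 4 < g)%N by lia.
apply: rst_trans (corner _ (ltnW i4)) _; have [c1 c2 c3 c4] := around _ i4.
have : (m = 4 * (m %/ 4) \/ m = 4 * (m %/ 4) + 1 \/ m = 4 * (m %/ 4) + 2
        \/ m = 4 * (m %/ 4) + 3)%N by lia.
case=> [{2}->|[|[|]] {2}->] //; first exact: rst_refl.
- by apply: rst_trans c1 _; apply: rst_trans c2 _; exact: c3.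
- by apply: rst_trans c1 _; exact: c2.
Qed.

Lemma glued_clos a b : glued a b -> clos a b.
Proof.
case=> [->|[k [s [kg s01 -> ->]]]|[[m mg ->] [n ng ->]]].
- exact: rst_refl.
- exact: clos_side.
- by apply: rst_trans (clos_vertex ng); apply: rst_sym; exact: clos_vertex.
Qed.

End PolygonRelation.

(** * The closed surface as an affine gluing *)

Section SurfaceGluing.
Local Open Scope ring_scope.

(** The relation on the square that defines the surface: the coincidences of
    elliptic coordinates ([Seam] and [Fold]), the pairing of sides, and the
    identification of all corners, which all lie on the edge [z.1 = 1]. *)
Variant surface_piece (g : nat) :=
  | Diagonal
  | Seam of bool
  | Fold
  | Side of 'I_(4 * g)
  | Corners of 'I_(4 * g).+1 & 'I_(4 * g).+1.

Definition encode_piece g (j : surface_piece g) :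
    bool + bool + ('I_(4 * g) + 'I_(4 * g).+1 * 'I_(4 * g).+1) :=
  match j with
  | Diagonal => inl (inl true)
  | Fold => inl (inl false)
  | Seam b => inl (inr b)
  | Side k => inr (inl k)
  | Corners k l => inr (inr (k, l))
  end.

Definition decode_piece g
    (c : bool + bool + ('I_(4 * g) + 'I_(4 * g).+1 * 'I_(4 * g).+1)) :
    surface_piece g :=
  match c with
  | inl (inl true) => Diagonal g
  | inl (inl false) => Fold g
  | inl (inr b) => Seam g b
  | inr (inl k) => Side k
  | inr (inr (k, l)) => Corners k l
  end.

Lemma encode_pieceK g : cancel (@encode_piece g) (@decode_piece g).
Proof. by case. Qed.

HB.instance Definition _ g := Finite.copy (surface_piece g) (can_type (@encode_pieceK g)).

Variables (R : realType) (g : nat).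
Hypothesis g_gt0 : (0 < g)%N.
Local Notation pos := (@pos R g).

Definition surface_left (j : surface_piece g) (t : R * R) : R * R :=
  match j with
  | Diagonal => t
  | Seam b => (t.1, b%:R)
  | Fold => (0, t.1)
  | Side k => (1, (k%:R + t.1) / (4 * g)%:R)
  | Corners k _ => (1, k%:R / (4 * g)%:R)
  end.

Definition surface_right (j : surface_piece g) (t : R * R) : R * R :=
  match j with
  | Diagonal => t
  | Seam b => (t.1, (~~ b)%:R)
  | Fold => (0, 1 - t.1)
  | Side k => (1, ((partner k)%:R + (1 - t.1)) / (4 * g)%:R)
  | Corners _ l => (1, l%:R / (4 * g)%:R)
  end.

Lemma cont_surface_left j : continuous (surface_left j).
Proof. by case: j => [|b||k|k l]; rewrite /surface_left /=; cont. Qed.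

Lemma cont_surface_right j : continuous (surface_right j).
Proof. by case: j => [|b||k|k l]; rewrite /surface_right /=; cont. Qed.

Lemma surface_left_seg j (z w : R * R) t :
  surface_left j (seg z w t) = seg (surface_left j z) (surface_left j w) t.
Proof. by case: j => // *; rewrite /seg /=; congr (_, _); lra. Qed.

Lemma surface_right_seg j (z w : R * R) t :
  surface_right j (seg z w t) = seg (surface_right j z) (surface_right j w) t.
Proof. by case: j => // *; rewrite /seg /=; congr (_, _); lra. Qed.

Lemma square_rim u : 0 <= u <= 1 -> unit_square ((1, u) : R * R).
Proof. by move=> u01; split => //=; lra. Qed.

Lemma surface_left_in j t : unit_square t -> unit_square (surface_left j t).
Proof.
move=> [t1 t2]; case: j => [|b||k|k l] /=; [by []| | | |].
- by split => //=; case: b => /=; lra.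
- by split => //=; lra.
- by apply/square_rim/(@pos_in R g g_gt0 k t.1).
- by apply: square_rim; rewrite -[k%:R]addr0; apply: pos_vertex_in; rewrite // -ltnS.
Qed.

Lemma surface_right_in j t : unit_square t -> unit_square (surface_right j t).
Proof.
move=> [t1 t2]; case: j => [|b||k|k l] /=; [by []| | | |].
- by split => //=; case: b => /=; lra.
- by split => /=; lra.
- apply/square_rim/(@pos_in R g g_gt0 _ (1 - t.1)); last by lra.
  exact: partner_lt.
- by apply: square_rim; rewrite -[l%:R]addr0; apply: pos_vertex_in; rewrite // -ltnS.
Qed.

Lemma surface_piece_fun j t t' :
  surface_left j t = surface_left j t' -> surface_right j t = surface_right j t'.
Proof.
have N0 : ((4 * g)%:R : R)^-1 != 0 by rewrite invr_eq0 gt_eqF // (N_gt0 R g_gt0).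
case: j => [|b||k|k l] //= [].
- by move->.
- by move->.
- by move=> /(mulIf N0)/addrI ->.
Qed.

(** A point of the circle has one preimage in the square, except for the point
    of angle [0], which is a corner. *)
Lemma glued_piece (z w : R * R) : unit_square z -> unit_square w ->
  glued g (ellipse z) (ellipse w) ->
  exists j, exists2 t, unit_square t & z = surface_left j t /\ w = surface_right j t.
Proof.
have Q0 (a : R) : 0 <= a <= 1 -> unit_square ((a, 0) : R * R).
  by move=> a01; split => //=; lra.
have corner (y : R * R) : unit_square y -> vertex g (ellipse y) ->
    exists m : 'I_(4 * g).+1, y = (1, m%:R / (4 * g)%:R).
  move=> Qy [m mg]; rewrite polygon_sideE -ellipse1.
  have mI : (m < (4 * g).+1)%N by rewrite ltnS.
  have Qm : unit_square ((1, pos m 0) : R * R).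
    exact/square_rim/pos_vertex_in.
  move=> /(ellipse_inj Qy Qm)[->|[b [yE [E _]]]|[_ [E]]].
  - by exists (Ordinal mI); rewrite /pos addr0.
  - rewrite yE -E; case: b {yE}; last by exists ord0; rewrite mul0r.
    by exists ord_max; rewrite /= mulfV // gt_eqF // (N_gt0 R g_gt0).
  - by have := oner_neq0 R; rewrite E eqxx.
have side_point (y : R * R) k s : (k < 4 * g)%N -> 0 <= s <= 1 -> unit_square y ->
    ellipse y = polygon_side g k s -> y = (1, pos k s) \/ vertex g (ellipse y).
  move=> kg s01 Qy E; have Qk : unit_square ((1, pos k s) : R * R).
    exact/square_rim/pos_in.
  have := E; rewrite polygon_sideE -ellipse1.
  move=> /(ellipse_inj Qy Qk)[->|[b [_ [_ E2]]]|[_ [E2]]]; first by left.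
    right; rewrite E; apply: (vertex_end g_gt0) => //.
    by case: b E2 => /= E2; [left; exact: pos_eq0 E2|right; exact: pos_eq1 E2].
  by have := oner_neq0 R; rewrite E2 eqxx.
have corners : unit_square z -> unit_square w -> vertex g (ellipse z) ->
    vertex g (ellipse w) -> exists j, exists2 t, unit_square t &
      z = surface_left j t /\ w = surface_right j t.
  move=> Qz Qw /(corner _ Qz)[k ->] /(corner _ Qw)[l ->].
  by exists (Corners k l); exists (0, 0) => //; apply: Q0; rewrite lexx ler01.
move=> Qz Qw zw; case: (zw) => [|[k [s [kg s01 zE wE]]]|[vz vw]]; last exact: corners.
  move=> /(ellipse_inj Qz Qw)[<-|[b [zE wE]]|[zE wE]].
  - by exists (Diagonal g); exists z.
  - by exists (Seam g b); exists (z.1, 0) => //; apply: Q0; case: Qz.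
  - by exists (Fold g); exists (z.2, 0) => //; apply: Q0; case: Qz.
have [zE'|vz] := side_point z k s kg s01 Qz zE; last first.
  by apply: corners => //; exact: (glued_vertex g_gt0 zw).
have s1 : 0 <= 1 - s <= 1 by lra.
have [wE'|vw] := side_point w _ _ (partner_lt kg) s1 Qw wE; last first.
  by apply: corners => //; apply: (glued_vertex g_gt0 (glued_sym zw)).
by exists (Side (Ordinal kg)); exists (s, 0); [exact: Q0|split].
Qed.

Lemma piece_glued j t : unit_square t ->
  glued g (ellipse (surface_left j t)) (ellipse (surface_right j t)).
Proof.
move=> [t1 t2]; case: j => [|[]||k|k l] /=.
- by constructor 1.
- by constructor 1; rewrite ellipse_seam.
- by constructor 1; rewrite ellipse_seam.
- by constructor 1; rewrite ellipse_fold.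
- constructor 2; exists k, t.1; split => //; by rewrite ellipse1.
- have vert (m : 'I_(4 * g).+1) : vertex g (ellipse ((1, m%:R / (4 * g)%:R) : R * R)).
    exists m; first by rewrite -ltnS.
    by rewrite ellipse1 polygon_sideE /pos addr0.
  by constructor 3.
Qed.

Variables (S : topologicalType) (q0 : R * R -> S).
Hypothesis q0_surj : q0 @` @unit_disk R = setT.
Hypothesis q0_quotient : forall U : set S, open U <-> exists2 V : set (R * R),
  open V & @unit_disk R `&` q0 @^-1` U = @unit_disk R `&` V.
Hypothesis q0_fibre : forall z w, unit_disk z -> unit_disk w ->
  (q0 z = q0 w <-> clos_refl_sym_trans (R * R) (side_pairing g) z w).

Definition surface_proj (z : R * R) : S := q0 (ellipse (clamp z.1, clamp z.2)).

Lemma surface_projE z : unit_square z -> surface_proj z = q0 (ellipse z).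
Proof. by case: z => a b [a01 b01]; rewrite /surface_proj !clamp_id. Qed.

Lemma cont_surface_proj : continuous surface_proj.
Proof.
have cc : continuous (fun z : R * R => ellipse (clamp z.1, clamp z.2)).
  by apply: (cont_comp (@cont_ellipse R)); cont.
apply/continuousP => U /q0_quotient[V oV UV].
have -> : surface_proj @^-1` U = (fun z : R * R => ellipse (clamp z.1, clamp z.2)) @^-1` V.
  apply/seteqP; split => z.
    move=> Uz; suff [] : (@unit_disk R `&` V) (ellipse (clamp z.1, clamp z.2)) by [].
    by rewrite -UV; split => //; apply: ellipse_disk; split; exact: clamp_in.
  move=> Vz; suff [] : (@unit_disk R `&` q0 @^-1` U) (ellipse (clamp z.1, clamp z.2)) by [].
  by rewrite UV; split => //; apply: ellipse_disk; split; exact: clamp_in.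
by move: V oV {UV}; apply/continuousP.
Qed.

Lemma surface_proj_surj y : exists2 z, unit_square z & surface_proj z = y.
Proof.
have [d Dd <-] : (q0 @` @unit_disk R) y by rewrite q0_surj.
have [z Qz <-] := ellipse_surj Dd.
by exists z => //; rewrite surface_projE.
Qed.

Lemma surface_fibre z w : unit_square z -> unit_square w ->
  (surface_proj z = surface_proj w <-> exists j, exists2 t, unit_square t &
     z = surface_left j t /\ w = surface_right j t).
Proof.
move=> Qz Qw; rewrite !surface_projE //; split.
  move=> /(q0_fibre (ellipse_disk Qz) (ellipse_disk Qw))/(clos_glued g_gt0).
  exact: glued_piece.
move=> [j [t Qt [zE wE]]].
apply/(q0_fibre (ellipse_disk Qz) (ellipse_disk Qw))/(glued_clos g_gt0).
by rewrite zE wE; exact: piece_glued.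
Qed.

(** The projection is a closed map: the saturation of a closed set is a finite
    union of continuous images of compact sets. *)
Lemma surface_usc y (V : set (R * R)) : open V ->
  (forall z, unit_square z -> surface_proj z = y -> V z) ->
  \forall y' \near y, forall z, unit_square z -> surface_proj z = y' -> V z.
Proof.
move=> oV Vy; apply: open_nbhs_nbhs; split => //.
pose K := \bigcup_(j in [set: surface_piece g])
  ((@ellipse R \o surface_left j) @` (@unit_square R `&` surface_right j @^-1` (~` V))).
have clK : closed K.
  apply: closed_bigcup => [|j _]; first exact: finite_finset.
  apply: compact_closed; first exact: norm_hausdorff.
  apply: continuous_compact.
    apply: continuous_subspaceT => z; apply: continuous_comp.
      exact: cont_surface_left.
    exact: cont_ellipse.
  apply: compact_closedI; first exact: compact_unit_square.
  apply: closed_comp; last exact: open_closedC.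
  by move=> z _; exact: cont_surface_right.
apply/q0_quotient; exists (~` K); first exact: closed_openC.
apply/seteqP; split => d [Dd Hd]; split => //.
  move=> [j _ [t [Qt nV] dE]]; apply: nV; apply: Hd; first exact: surface_right_in.
  have Ql := @surface_left_in j t Qt; have Qr := @surface_right_in j t Qt.
  rewrite -dE /= -surface_projE //; symmetry; apply/surface_fibre => //.
  by exists j, t.
move=> w Qw qw; apply: contrapT => nVw; apply: Hd.
have [z Qz zE] := ellipse_surj Dd.
have : surface_proj z = surface_proj w by rewrite qw surface_projE // zE.
move=> /(surface_fibre Qz Qw)[j [t Qt [zE' wE]]].
exists j => //; exists t; last by rewrite /= -zE'.
by split => //=; rewrite -wE.
Qed.

Definition surface_gluing : affine_gluing R S :=
  @AffineGluing R S surface_proj (surface_piece g) surface_left surface_right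
    cont_surface_proj surface_proj_surj cont_surface_left cont_surface_right
    surface_left_seg surface_right_seg surface_fibre surface_left_in
    surface_right_in (fun j t t' _ _ => @surface_piece_fun j t t') surface_usc.

End SurfaceGluing.

(** * The surface group, presented by labels of corners *)

Section SurfacePresentation.
Local Open Scope ring_scope.

(** Side [k] of the polygon carries the element [(v k)^-1 * v k.+1], so that
    [v k] is the value of the prefix of length [k] of the boundary word.  Glued
    sides carry inverse elements, being run through in opposite directions.  Such
    labels amount to a solution in [H] of the surface relation. *)
Definition corner_labels (g : nat) (H : groupType) (v : nat -> H) :=
  [/\ v 0%N = 1%g, v (4 * g)%N = 1%g &
      forall k, (k < 4 * g)%N ->
        ((v k)^-1 * v k.+1 = (v (partner k).+1)^-1 * v (partner k))%g].

Section Labels.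
Variables (R : realType) (g : nat) (H : groupType) (v : nat -> H).
Hypothesis g_gt0 : (0 < g)%N.
Hypothesis v_labels : corner_labels g v.
Local Notation N := ((4 * g)%:R : R).

(** An inner point of a side carries the label of the corner where the side
    starts, for the first sides [a] and [b] of a pair, and where it ends, for the
    sides [a^-1] and [b^-1]: these corners are glued to each other. *)
Definition rim_label (a : R) : H :=
  let m := Num.truncn a in
  if a == m%:R then v m else if (m %% 4 < 2)%N then v m else v m.+1.

Definition square_label (z : R * R) : H :=
  if z.1 == 1 then rim_label (z.2 * N) else 1%g.

Lemma rim_label_nat k : rim_label k%:R = v k.
Proof. by rewrite /rim_label natrK eqxx. Qed.

Lemma rim_label_mid k s : 0 < s < 1 ->
  rim_label (k%:R + s) = if (k %% 4 < 2)%N then v k else v k.+1.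
Proof.
move=> s01; have kE : Num.truncn (k%:R + s) = k.
  by apply: truncn_def; rewrite -natr1; lra.
by rewrite /rim_label kE ifF //; apply/negbTE; rewrite gt_eqF //; lra.
Qed.

Lemma square_label_rim (a : R) : square_label (1, a / N) = rim_label a.
Proof. by rewrite /square_label /= eqxx mulfVK // gt_eqF // (N_gt0 R g_gt0). Qed.

Definition piece_value (j : surface_piece g) : H :=
  match j with
  | Side k => (v k * (v (partner k).+1)^-1)%g
  | Corners k l => (v k * (v l)^-1)%g
  | _ => 1%g
  end.

Lemma square_label_piece j (t : R * R) : unit_square t ->
  (square_label (surface_left j t) * (square_label (surface_right j t))^-1
   = piece_value j)%g.
Proof.
have [v0 vN vk] := v_labels.
have seam (r : R) : square_label (r, 0) = square_label (r, 1).
  rewrite /square_label /=; case: ifP => // _.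
  by rewrite mul0r mul1r -[0]/(0%:R) !rim_label_nat v0 vN.
move=> [t1 t2]; case: j => [|b||k|k l] /=.
- by rewrite mulgV.
- by case: b; rewrite /= ?seam mulgV.
- by rewrite /square_label /= (eq_sym 0) oner_eq0 mulgV.
- rewrite !square_label_rim.
  have rel : (v k * (v (partner k).+1)^-1 = v k.+1 * (v (partner k))^-1)%g.
    have := vk k (ltn_ord k) => E; apply: (mulgI (v k)^-1%g).
    by rewrite mulKg mulgA E mulgK.
  have [s0|s0] := eqVneq t.1 0.
    by rewrite s0 addr0 subr0 natr1 !rim_label_nat.
  have [s1|s1] := eqVneq t.1 1.
    by rewrite s1 subrr addr0 natr1 !rim_label_nat rel.
  have s01 : 0 < t.1 < 1 by rewrite !lt_neqAle s1 (eq_sym 0) s0.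
  rewrite !rim_label_mid //; last by lra.
  have [k2|k2] := ltnP (k %% 4) 2.
    by rewrite ifF // /partner ifT //; lia.
  by rewrite ifT ?rel // /partner ifF; lia.
- by rewrite !square_label_rim !rim_label_nat.
Qed.

End Labels.

(** The labels [u k] are transitions from the corners to corner [0].  Constancy
    of transitions along the pieces [Side k] gives the relations, and an
    arbitrary labelling of the corners extends to a function on the square with
    constant transitions. *)
Theorem surface_presentation (R : realType) (g : nat) (Gamma : groupType) :
  (0 < g)%N -> surface_group R g Gamma ->
  exists u : nat -> Gamma, [/\ corner_labels g u,
    generates [set u k | k in [set k | (k <= 4 * g)%N]] &
    forall (H : groupType) (v : nat -> H), corner_labels g v ->
      exists f : group_hom Gamma H, forall k, (k <= 4 * g)%N -> f (u k) = v k].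
Proof.
move=> g_gt0 [S [x [[q0 [surj quo fib]] [cls [cls_surj cls_homotopic cls_concat]]]]].
pose D := surface_gluing g_gt0 surj quo fib.
pose mu := develop x cls D.
pose N := (4 * g)%:R : R.
have N_neq0 : N != 0 by rewrite gt_eqF // (N_gt0 R g_gt0).
have mu_piece (j : surface_piece g) (t t' : R * R) :
    unit_square t -> unit_square t' ->
    (mu (surface_left j t) * (mu (surface_right j t))^-1
     = mu (surface_left j t') * (mu (surface_right j t'))^-1)%g.
  exact: (develop_piece cls_homotopic cls_concat (D := D)).
have Qu (a : R) : 0 <= a <= 1 -> unit_square ((a, 0) : R * R).
  by move=> a01; split => //=; lra.
have Q0 : unit_square ((0, 0) : R * R) by apply: Qu; lra.
have Q1 : unit_square ((1, 0) : R * R) by apply: Qu; lra.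
have Qh : unit_square ((2^-1, 0) : R * R) by apply: Qu; lra.
pose corner (k : nat) : R * R := (1, k%:R / N).
pose u k := (mu (corner k) * (mu (corner 0%N))^-1)%g.
(* The fold relates [(0, 1/2)] to itself. *)
have fold_value t : unit_square t ->
    (mu (surface_left (Fold g) t) * (mu (surface_right (Fold g) t))^-1 = 1)%g.
  move=> Qt; rewrite (mu_piece _ _ _ Qt Qh) /= (_ : 1 - 2^-1 = 2^-1) ?mulgV //.
  by lra.
(* The seam and the fold meet at [(0, 0)]. *)
have seam_value b t : unit_square t ->
    (mu (surface_left (Seam g b) t) * (mu (surface_right (Seam g b) t))^-1 = 1)%g.
  move=> Qt; rewrite (mu_piece _ _ _ Qt Q0) /=.
  have /divg1_eq := fold_value _ Q0; rewrite /= subr0 => E.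
  by case: b; rewrite /= E mulgV.
have side_value (k : 'I_(4 * g)) t : unit_square t ->
    (mu (surface_left (Side k) t) * (mu (surface_right (Side k) t))^-1
     = u k * (u (partner k).+1)^-1)%g.
  move=> Qt; rewrite (mu_piece _ _ _ Qt Q0) /= addr0 subr0 natr1.
  by rewrite /u mulgKA.
have uN : u (4 * g)%N = 1%g.
  have /divg1_eq := seam_value true _ Q1; rewrite /= => E.
  by rewrite /u /corner mulfV // mul0r E mulgV.
have labels_u : corner_labels g u.
  split=> // [|k kg]; first by rewrite /u mulgV.
  have E := side_value (Ordinal kg) _ Q1; rewrite /= subrr addr0 natr1 in E.
  have {}E : (u k.+1 * (u (partner k))^-1 = u k * (u (partner k).+1)^-1)%g.
    by rewrite -E /u mulgKA.
  apply: (mulgI (u k)); apply: (mulIg (u (partner k))^-1%g).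
  by rewrite mulVKg E mulgA mulgK.
exists u; split => //.
  move=> P [P1 PM PV] Pu.
  have Pd k l : (k <= 4 * g)%N -> (l <= 4 * g)%N -> P (u k * (u l)^-1)%g.
    by move=> kg lg; apply: PM; [|apply: PV]; apply: Pu; [exists k|exists l].
  apply: (transitions_generate cls_homotopic cls_concat cls_surj (D := D)) => //.
  move=> _ [w [w' [Qw Qw' qww' ->]]].
  have [j [t Qt [-> ->]]] := (surface_fibre g_gt0 fib Qw Qw').1 qww'.
  case: j => [|b||k|k l].
  - by rewrite /= mulgV.
  - by have := seam_value b t Qt; rewrite /mu => ->.
  - by have := fold_value t Qt; rewrite /mu => ->.
  - have := side_value k t Qt; rewrite /mu => ->.
    by apply: Pd; [exact: ltnW|exact: partner_lt].
  - have <- : (u k * (u l)^-1 = mu (surface_left (Corners k l) t)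
        * (mu (surface_right (Corners k l) t))^-1)%g by rewrite /u mulgKA.
    by apply: Pd; rewrite -ltnS.
move=> H v v_labels; have [v0 _ _] := v_labels.
have lam_piece (j : piece D) (t t' : R * R) : unit_square t -> unit_square t' ->
    (square_label g v (left_of j t) * (square_label g v (right_of j t))^-1
     = square_label g v (left_of j t') * (square_label g v (right_of j t'))^-1)%g.
  move=> Qt Qt'.
  have E := square_label_piece g_gt0 v_labels (R := R) j Qt.
  have E' := square_label_piece g_gt0 v_labels (R := R) j Qt'.
  exact: etrans E (esym E').
have [f fE] := transitions_extend cls_homotopic cls_concat cls_surj lam_piece.
exists f => k kg.
have Qk m : (m <= 4 * g)%N -> unit_square (corner m).
  move=> mg; apply: square_rim; have := pos_vertex_in R g_gt0 mg.
  by rewrite /pos addr0.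
rewrite (fE _ _ (Qk _ kg) (Qk 0%N _)) //.
  by rewrite !square_label_rim // !rim_label_nat v0 invg1 mulg1.
apply/(surface_fibre g_gt0 fib (Qk _ kg) (Qk 0%N _)) => //.
have kI : (k < (4 * g).+1)%N by rewrite ltnS.
by exists (Corners (Ordinal kI) ord0); exists (0, 0).
Qed.

End SurfacePresentation.

(** * Dehn twists *)

Section SurfaceTwists.
Local Open Scope group_scope.
Variables (g : nat) (Gamma : groupType) (u : nat -> Gamma).
Hypothesis u_labels : corner_labels g u.
Hypothesis u_generates : generates [set u k | k in [set k | (k <= 4 * g)%N]].
Hypothesis u_universal : forall (H : groupType) (v : nat -> H), corner_labels g v ->
  exists f : group_hom Gamma H, forall k, (k <= 4 * g)%N -> f (u k) = v k.

Definition side_loop (k : nat) : Gamma := (u k)^-1 * u k.+1.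

Lemma u_hom_eq (H : groupType) (f f' : group_hom Gamma H) :
  (forall k, (k <= 4 * g)%N -> f (u k) = f' (u k)) -> f =1 f'.
Proof.
move=> ff'; apply: (u_generates (P := [set c | f c = f' c])).
  split=> /= [|a b ab ab'|a aa]; first by rewrite !gmulf1.
    by rewrite !gmulfM ab ab'.
  by rewrite !gmulfV aa.
by move=> _ [k kg <-]; exact: ff'.
Qed.

Definition twisted (k0 : nat) (z : Gamma) (k : nat) : Gamma :=
  if (k == k0) || (k == k0.+1) then u k * z else u k.

(** Side [k0] is the second or third side of a block [a b a^-1 b^-1], and [z]
    commutes with its loop [d].  Multiplying the labels of both ends of this side
    by [z] keeps [d] and changes the element carried by the side before it and by
    the side after it, which are glued to each other.  For [z = d ^+ m] the
    corresponding endomorphism is the [m]-th power of the Dehn twist along [d]. *)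
Lemma twisted_labels k0 z : (k0 < 4 * g)%N -> (1 <= k0 %% 4 <= 2)%N ->
  commute (side_loop k0) z -> corner_labels g (twisted k0 z).
Proof.
move=> k0g k04 comm; have [u0 uN uk] := u_labels.
have outside k : k != k0 -> k != k0.+1 -> twisted k0 z k = u k.
  by rewrite /twisted => /negPf -> /negPf ->.
have at0 : twisted k0 z k0 = u k0 * z by rewrite /twisted eqxx.
have at1 : twisted k0 z k0.+1 = u k0.+1 * z by rewrite /twisted eqxx orbT.
split; try by rewrite outside //; apply/eqP; lia.
(* The relations of glued sides are inverse to each other. *)
move=> k kg; wlog k2 : k kg / (k %% 4 < 2)%N => [wlog_k|].
  have [k2|k2] := ltnP (k %% 4) 2; first exact: wlog_k.
  have k'2 : (partner k %% 4 < 2)%N by rewrite /partner ifF; lia.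
  have := wlog_k _ (partner_lt kg) k'2; rewrite partnerK => E.
  have := congr1 (fun a => a^-1) E; rewrite !invgM !invgK => {}E.
  by rewrite E.
have kE : partner k = k.+2 by rewrite /partner k2.
have uk2 := uk k kg; rewrite kE in uk2 *.
have [k0E|nk1] := eqVneq k0 k.+1.
  rewrite -k0E in uk2 *; rewrite at0 at1 !outside; try by apply/eqP; lia.
  by rewrite !mulgA uk2.
have [k0E|nk] := eqVneq k0 k.
  rewrite -k0E in uk2 *; rewrite at0 at1 !outside; try by apply/eqP; lia.
  rewrite -uk2 invgM -mulgA (mulgA (u k0)^-1).
  by rewrite -/(side_loop k0) comm mulKg.
have [k0E|nk2] := eqVneq k0 k.+2.
  rewrite -k0E in uk2 *; rewrite at0 at1 !outside; try by apply/eqP; lia.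
  have commV : commute z (side_loop k0)^-1 by apply/commuteV/commute_sym.
  have dE : (u k0.+1)^-1 * u k0 = (side_loop k0)^-1.
    by rewrite /side_loop invgM invgK.
  rewrite uk2 invgM -mulgA (mulgA (u k0.+1)^-1) dE.
  by apply: (mulgI z); rewrite mulVKg.
by rewrite !outside // ; apply/eqP; lia.
Qed.

Lemma twist_exists k0 z : (k0 < 4 * g)%N -> (1 <= k0 %% 4 <= 2)%N ->
  commute (side_loop k0) z -> exists f : group_hom Gamma Gamma,
    (forall k, (k <= 4 * g)%N -> f (u k) = twisted k0 z k) /\
    f (side_loop k0) = side_loop k0.
Proof.
move=> k0g k04 comm; have [f fE] := u_universal (twisted_labels k0g k04 comm).
exists f; split => //; rewrite /side_loop gmulfM gmulfV !fE //; last exact: ltnW.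
rewrite /twisted !eqxx orbT invgM -mulgA (mulgA (u k0)^-1).
by rewrite -/(side_loop k0) comm mulKg.
Qed.

(** The inverse automorphism is the twist by [side_loop k0 ^- m]. *)
Lemma surface_twist k0 m : (k0 < 4 * g)%N -> (1 <= k0 %% 4 <= 2)%N ->
  exists2 phi, group_aut Gamma phi & phi (u k0) = u k0 * side_loop k0 ^+ m.
Proof.
move=> k0g k04; set d := side_loop k0.
have comm : commute d (d ^+ m) by exact: commuteX.
have commV : commute d (d ^- m) by exact: commuteV.
have [f [fE fd]] := twist_exists k0g k04 comm.
have [f' [f'E f'd]] := twist_exists k0g k04 commV.
exists f; last by rewrite fE ?(ltnW k0g) // /twisted eqxx.
suff: bijective f by [].
exists f' => c.
  apply: (@u_hom_eq _ (f' \o f : group_hom Gamma Gamma) idfun) => k kg /=.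
  rewrite fE // /twisted; case: ifP => kk0; last by rewrite f'E // /twisted kk0.
  by rewrite gmulfM gmulfXn f'd f'E // /twisted kk0 mulgVK.
apply: (@u_hom_eq _ (f \o f' : group_hom Gamma Gamma) idfun) => k kg /=.
rewrite f'E // /twisted; case: ifP => kk0; last by rewrite fE // /twisted kk0.
by rewrite gmulfM gmulfV gmulfXn fd fE // /twisted kk0 mulgK.
Qed.

(** A side that is not twisted along is glued to one that is. *)
Lemma side_loops_generate : generates [set side_loop k |
  k in [set k | (k < 4 * g)%N && (1 <= k %% 4 <= 2)%N]].
Proof.
have [u0 uN uk] := u_labels.
move=> P [P1 PM PV] Pd; apply: u_generates => // _ [k kg <-].
have Pside k0 : (k0 < 4 * g)%N -> P (side_loop k0).
  have mid k1 : (k1 < 4 * g)%N -> (1 <= k1 %% 4 <= 2)%N -> P (side_loop k1).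
    by move=> kg' k4; apply: Pd; exists k1 => //=; rewrite kg'.
  move=> k0g; have [k04|k04] := boolP (1 <= k0 %% 4 <= 2)%N; first exact: mid.
  have -> : side_loop k0 = (side_loop (partner k0))^-1.
    by rewrite /side_loop invgM invgK uk.
  apply/PV/mid; first exact: partner_lt.
  by rewrite /partner; case: ifP; lia.
elim: k kg => [|k IHk] kg; first by rewrite u0.
have -> : u k.+1 = u k * side_loop k by rewrite /side_loop mulVKg.
by apply: PM; [apply: IHk; exact: ltnW|exact: Pside].
Qed.

End SurfaceTwists.

Lemma surface_group_case (R : realType) (g : nat) (Gamma G : groupType)
    (rho : group_hom Gamma G) : (2 <= g)%N -> surface_group R g Gamma ->
  finite_set (aut_orbit rho) -> finite_set (range rho).
Proof.
move=> g2 surf.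
have [u [u_labels u_gen u_univ]] := surface_presentation (ltnW g2) surf.
apply: finite_range_of_twists (side_loops_generate u_labels u_gen) _.
  apply: finite_image; apply: (@sub_finite_set _ _ `I_(4 * g)); last exact: finite_II.
  by move=> k /andP[].
move=> _ [k /andP[kg k4] <-]; exists (u k) => m.
exact: (surface_twist u_labels u_gen u_univ m kg k4).
Qed.

Theorem theorem1p1 (R : realType) (Gamma G : groupType)
    (hGamma : (exists g : nat, (2 <= g)%N /\ surface_group R g Gamma) \/
              (exists n : nat, (2 <= n)%N /\ free_group_of_rank n Gamma))
    (rho : group_hom Gamma G) (horbit : finite_set (aut_orbit rho)) :
  finite_set (range rho).
Proof.
case: hGamma => [[g [g2 surf]]|[n [n2 free]]].
  exact: surface_group_case g2 surf horbit.
exact: free_group_case n2 free horbit.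
Qed.
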